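(* Let $f\in \mathrm{EP}(\mathbb{R}^N)$ be an exponential-polynomial function. For each conic chamber $\mathfrak{c}$ of the cone $C(\Phi)$, there exists an exponential-polynomial function $\mathcal{P}[\mathfrak{c},f,\Phi]$ on $V^*$ such that, for each $\lambda\in(\mathfrak{c}-\Box(\Phi))\cap\Gamma^*$, we have $$\mathcal{S}[f,\Phi](\lambda)=\mathcal{P}[\mathfrak{c},f,\Phi](\lambda).$$
   Context: $V$ is an $n$-dimensional real vector space with a rank-$n$ lattice $\Gamma\subset V$, and $\Gamma^*\subset V^*$ is the dual lattice. $\Phi=[\beta_1,\dots,\beta_N]$ is a sequence of not necessarily distinct elements of $\Gamma^*$ which span $V^*$ and lie entirely in an open halfspace of $V^*$. $C(\Phi)=\sum_{i=1}^N\mathbb{R}_{\ge 0}\beta_i$ is the closed cone generated by $\Phi$. The conic chambers of $C(\Phi)$ are the connected components of the complement in $C(\Phi)$ of the union of the $(n-1)$-dimensional closed cones generated by linearly independent $(n-1)$-tuples of elements of $\Phi$ (they are open cones). $\Box(\Phi)=\sum_{i=1}^N[0,1]\beta_i$ (Minkowski sum), and $\mathfrak{c}-\Box(\Phi)=\{x-y : x\in\mathfrak{c},\ y\in\Box(\Phi)\}$. For $a\in V^*$, the partition polytope is $\Pi_\Phi(a)=\{\mathbf{x}\in\mathbb{R}^N : x_k\ge 0 \text{ for all } k,\ \sum_{k=1}^N x_k\beta_k=a\}$ (empty if $a\notin C(\Phi)$). For a function $f$ on $\mathbb{R}^N$ and $\lambda\in\Gamma^*$, $\mathcal{S}[f,\Phi](\lambda)=\sum_{\xi\in\Pi_\Phi(\lambda)\cap\mathbb{Z}^N}f(\xi)$.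 An exponential-polynomial function on a finite-dimensional real vector space $W$ is a complex function of the form $w\mapsto\sum_{j=1}^m e^{\langle y_j,w\rangle}P_j(w)$, where each $y_j$ is a complex-valued linear form on $W$ and each $P_j$ is a polynomial with complex coefficients; $\mathrm{EP}(\mathbb{R}^N)$ is the ring of such functions on $\mathbb{R}^N$. *)

(* Defs.v *)
From HB Require Import structures.
From mathcomp Require Import all_boot all_order all_algebra.
From mathcomp Require Import all_classical all_reals all_analysis.
From mathcomp Require Import complex.
(* Not imported: its notations clash with those of mathcomp-analysis. *)
From mathcomp Require mpoly.

Set Implicit Arguments.
Unset Strict Implicit.
Unset Printing Implicit Defensive.

Import Order.TTheory GRing.Theory Num.Theory numFieldNormedType.Exports.

Local Open Scope classical_set_scope.
Local Open Scope ring_scope.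
Local Open Scope complex_scope.

Definition cexp (R : realType) (z : R[i]) : R[i] :=
  (expR (complex.Re z) * cos (complex.Im z))
    +i* (expR (complex.Re z) * sin (complex.Im z)).

Definition coords (R : realType) (W : vectType R) (w : W) :
    'rV[R]_(\dim {:W}) :=
  \row_i coord (vbasis {:W}) i w.

Definition poly_eval (R : realType) (W : vectType R)
    (P : mpoly.mpoly (\dim {:W}) R[i]) (w : W) : R[i] :=
  mpoly.meval (fun i => (coords w 0 i)%:C) P.

(* [Rcomplex R] is R[i] with its structure of R-module, so that the [y j] are
   the complex-valued R-linear forms on W. *)
Definition exp_polynomial (R : realType) (W : vectType R) (f : W -> R[i]) :=
  exists (m : nat) (y : 'I_m -> {linear W -> Rcomplex R})
         (P : 'I_m -> mpoly.mpoly (\dim {:W}) R[i]),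
  forall w, f w = \sum_(j < m) cexp (y j w) * poly_eval (P j) w.

Definition lattice (R : realType) (V : vectType R) (n : nat) (G : set V) :=
  exists2 b : n.-tuple V, free b &
    G = [set v | exists z : 'I_n -> int, v = \sum_(i < n) tnth b i *~ z i].

Definition dual_lattice (R : realType) (V : vectType R) (G : set V) :
    set 'Hom(V, R^o) :=
  [set l | forall g, G g -> (l g : R) \is a Num.int].

Definition in_open_halfspace (R : realType) (V : vectType R)
    (s : seq 'Hom(V, R^o)) :=
  exists2 v : V, v != 0 & forall l : 'Hom(V, R^o), l \in s -> 0 < (l v : R).

Section Cones.
Variables (R : realType) (W : vectType R).
Implicit Type s : seq W.

Definition closed_cone s : set W :=
  [set x | exists2 t : 'I_(size s) -> R, (forall i, 0 <= t i) &
     x = \sum_(i < size s) t i *: s`_i].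

Definition box s : set W :=
  [set x | exists2 t : 'I_(size s) -> R, (forall i, 0 <= t i <= 1) &
     x = \sum_(i < size s) t i *: s`_i].

(* The condition on the size of [u] rather than [size u = (\dim {:W}).-1]
   leaves no wall when W is zero. *)
Definition walls s : set W :=
  [set x | exists u : seq W, [/\ {subset u <= s}, (size u).+1 = \dim {:W},
     free u & closed_cone u x]].

(* The usual topology of a finite dimensional real vector space. *)
Definition vtopology : topologicalType := initial_topology (@coords R W).

Definition conic_chamber s (c : set W) :=
  exists2 x, (closed_cone s `\` walls s) x &
    c = @connected_component vtopology (closed_cone s `\` walls s) x.

Definition partition_polytope (N : nat) (Phi : N.-tuple W) (a : W) :
    set 'rV[R]_N :=
  [set x | (forall k, 0 <= x 0 k) /\ \sum_(k < N) x 0 k *: tnth Phi k = a].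

Definition integer_points (N : nat) : set 'rV[R]_N :=
  [set x | forall k, x 0 k \is a Num.int].

(* A finitely supported sum: when [Phi] lies in an open halfspace the
   partition polytopes are bounded, so the set of indices is finite. *)
Definition partition_sum (N : nat) (f : 'rV[R]_N -> R[i]) (Phi : N.-tuple W)
    (lambda : W) : R[i] :=
  \sum_(xi \in partition_polytope Phi lambda `&` @integer_points N) f xi.

End Cones.

(* Main.v *)
Require Import Defs.
From HB Require Import structures.
From mathcomp Require Import all_boot all_order all_algebra.
From mathcomp Require Import all_classical all_reals all_analysis.
From mathcomp Require Import complex ring lra.
(* Only the canonical structures: its notations clash with mathcomp-analysis. *)
Import -(notations) mpoly.

(* Replacing beta_k by m_k + 1 copies of itself turns the weight u^x into
   u^x binomial(x + m_k, m_k), and such weights span EP(R^N) on N^N, so only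
   weights prod_k u_k^(x_k) matter.  Let A_k be the operator
   F |-> u_k F(. - beta_k).  The sums S_J over the subfamilies J of Phi satisfy
   (1 - A_k) S_J = S_(J \ k).  If J contains a basis properly, an integer
   relation sum_k r_k beta_k = 0 gives 1 - u^r = sum_k q_k (1 - A_k) for some
   combinations of translations q_k, and P_J = (1 - u^r)^-1 sum_k q_k P_(J \ k)
   defines functions with (1 - A_k) P_J = P_(J \ k), starting from characters
   supported on the lattice generated by a basis of Phi whose cone contains the
   chamber.  To divide by 1 - u^r also when u^r = 1, u_k is deformed to
   u_k e^(g_k t) with g generic and one works with power series in t.

   By induction the defect D = S_J - P_J satisfies D(l + beta_k) = u_k D(l) as
   long as l + beta_k lies in c - Box(J \ k).  If l = x - sum_k t_k beta_k with x
   in c and t in [0,1]^J, let x move away along its ray, absorbing the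
   displacement in t and replacing l by l + beta_k whenever t_k reaches 1: this
   transports D(l) deep into c, where the relation gives (1 - u^r) D = 0. *)

Set Implicit Arguments.
Unset Strict Implicit.
Unset Printing Implicit Defensive.

Import Order.TTheory GRing.Theory Num.Theory numFieldNormedType.Exports.

Local Open Scope ring_scope.

(** * Partition sums as iterated convolutions *)

Section Convolution.
Variables (R : archiRealFieldType) (W : zmodType) (A : comNzRingType).
Variables (h : {additive W -> R}).
Implicit Types (g : nat -> A) (F : W -> A).

Definition height_supported F := forall x, F x != 0 -> 0 <= h x.

(** Convolution with the series [sum_j g j [j b]]. The cutoff loses no term: if [1 <= h b] and [F]
    is supported on [h >= 0], then [F (x - b *+ j)] vanishes once [j > h x]. *)
Definition conv g (b : W) F (x : W) : A :=
  \sum_(j < (Num.truncn (h x)).+1) g j * F (x - b *+ j).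

Definition delta0 (x : W) : A := (x == 0)%:R.

Lemma delta0_supported : height_supported delta0.
Proof.
move=> x; rewrite /delta0; have [->|_] := eqVneq x 0; first by rewrite raddf0.
by rewrite eqxx.
Qed.

Lemma conv_widen g b F x m : 1 <= h b -> height_supported F ->
  (Num.truncn (h x) < m)%N ->
  conv g b F x = \sum_(j < m) g j * F (x - b *+ j).
Proof.
move=> hb hF hm; rewrite /conv.
rewrite -!(big_mkord xpredT (fun j => g j * F (x - b *+ j))).
rewrite [RHS](big_cat_nat (n := (Num.truncn (h x)).+1)) //=.
rewrite [X in _ = _ + X]big_nat_cond [X in _ = _ + X]big1 ?addr0 // => j.
rewrite andbT => /andP[hj _].
have [->|Fn0] := eqVneq (F (x - b *+ j)) 0; first by rewrite mulr0.
have := hF _ Fn0; rewrite raddfB raddfMn subr_ge0 => /le_trans.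
have {}hb : j%:R <= h b *+ j by rewrite lerMn2r hb orbT.
move=> /(_ _ (lexx _)) /(le_trans hb).
rewrite leNgt => /negP[]; apply: (lt_le_trans (truncnS_gt _)).
by rewrite ler_nat.
Qed.

Lemma conv_supported g b F : 1 <= h b -> height_supported F ->
  height_supported (conv g b F).
Proof.
move=> hb hF x; rewrite leNgt; apply: contra => hx; rewrite /conv big1 // => j _.
have [->|/hF] := eqVneq (F (x - b *+ j)) 0; first by rewrite mulr0.
rewrite raddfB raddfMn subr_ge0 => hj; have := le_lt_trans hj hx.
by rewrite ltNge mulrn_wge0 // (le_trans _ hb).
Qed.

Lemma truncn_height_shift (b x : W) j : 1 <= h b ->
  (Num.truncn (h (x - b *+ j)%R) <= Num.truncn (h x))%N.
Proof.
move=> hb; apply: le_truncn; rewrite raddfB raddfMn gerBl mulrn_wge0 //.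
exact: le_trans hb.
Qed.

Lemma convC g1 b1 g2 b2 F : 1 <= h b1 -> 1 <= h b2 -> height_supported F ->
  conv g1 b1 (conv g2 b2 F) =1 conv g2 b2 (conv g1 b1 F).
Proof.
move=> h1 h2 hF x; have cE g b F' : conv g b F' x =
  \sum_(j < (Num.truncn (h x)).+1) g j * F' (x - b *+ j) by [].
rewrite !cE.
have w g (b y : W) j : 1 <= h b -> 1 <= h y ->
    conv g b F (x - y *+ j) =
    \sum_(i < (Num.truncn (h x)).+1) g i * F (x - y *+ j - b *+ i).
  by move=> hb hy; apply: conv_widen => //; rewrite ltnS truncn_height_shift.
under eq_bigr do rewrite w // mulr_sumr.
under [RHS]eq_bigr do rewrite w // mulr_sumr.
rewrite exchange_big /=; apply: eq_bigr => i _; apply: eq_bigr => j _.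
by rewrite addrAC mulrCA.
Qed.

Lemma eq_conv g b F F' : F =1 F' -> conv g b F =1 conv g b F'.
Proof. by move=> e x; apply: eq_bigr => j _; rewrite e. Qed.

(** The geometric series inverts [1 - u [b]]: after an index shift every term but [j = 0]
    cancels. *)
Lemma conv_geometric (u : A) b F x : 1 <= h b -> height_supported F ->
  conv (GRing.exp u) b F x - u * conv (GRing.exp u) b F (x - b) = F x.
Proof.
move=> hb hF.
(* The two cutoffs are made to differ by one, so that the terms pair up once [j = 0] is split
   off. *)
rewrite (@conv_widen _ _ _ _ (Num.truncn (h x)).+2) //.
rewrite (@conv_widen _ _ _ (x - b) (Num.truncn (h x)).+1) //; last first.
  by rewrite ltnS -[b in x - b]mulr1n truncn_height_shift.
rewrite big_ord_recl mulr0n subr0 expr0 mul1r mulr_sumr -addrA -sumrB big1 ?addr0 //.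
by move=> j _; rewrite /= exprS mulrS opprD addrA mulrA subrr.
Qed.

Section Iterate.
Variables (T : eqType) (g : T -> nat -> A) (b : T -> W).
Hypothesis hb : forall k, 1 <= h (b k).

Definition iter_conv (s : seq T) : W -> A :=
  foldr (fun k F => conv (g k) (b k) F) delta0 s.

Lemma iter_conv_supported s : height_supported (iter_conv s).
Proof.
elim: s => [|k s IH] /=; first exact: delta0_supported.
exact: conv_supported.
Qed.

Lemma iter_conv_rem s k : k \in s ->
  iter_conv s =1 conv (g k) (b k) (iter_conv (rem k s)).
Proof.
elim: s => // i s IH; rewrite inE /=; have [->//|ik /= ks] := eqVneq i k.
move=> x; rewrite (eq_conv _ _ (IH ks)) convC //; exact: iter_conv_supported.
Qed.

End Iterate.

Lemma iter_conv_combination (T : finType) (g : T -> nat -> A) (b : T -> W) s x :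
  uniq s -> iter_conv g b s x != 0 ->
  exists2 m : T -> nat, forall k, k \notin s -> m k = 0%N & x = \sum_k b k *+ m k.
Proof.
elim: s x => [|k s IH] x /=.
  rewrite /delta0; have [-> _ _|_ _] := eqVneq x 0; last by rewrite eqxx.
  by exists (fun=> 0%N) => //; rewrite big1 // => k _; rewrite mulr0n.
move=> /andP[ks us] S0.
have [j Fj] : exists j, iter_conv g b s (x - b k *+ j) != 0.
  have [/existsP[j]|] := boolP [exists j : 'I_(Num.truncn (h x)).+1,
    iter_conv g b s (x - b k *+ j) != 0]; first by exists j.
  rewrite negb_exists => /forallP F0; move: S0; rewrite /conv big1 ?eqxx // => j _.
  by have := F0 j; rewrite negbK => /eqP ->; rewrite mulr0.
have [m m0 xE] := IH _ us Fj.
exists (fun i => if i == k then j else m i) => [i|].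
  by rewrite inE negb_or => /andP[/negbTE -> /m0].
rewrite -[x](subrK (b k *+ j)) xE (bigD1 k) //= m0 // mulr0n add0r.
rewrite [RHS](bigD1 k) //= eqxx addrC; congr (_ + _).
by apply: eq_bigr => i /negbTE ->.
Qed.

End Convolution.

(** * Repeated vectors and binomial weights *)

Section Multiplicities.
Variables (R : archiRealFieldType) (W : zmodType) (A : comNzRingType).
Variables (h : {additive W -> R}).
Implicit Types (g : nat -> A) (F : W -> A).

(** In generating series the hypotheses on [g] and [g'] say [(1 - u z) g(z) = g'(z)]. *)
Lemma conv_twdiff (u : A) g g' b F x : 1 <= h b -> height_supported h F ->
  g 0%N = g' 0%N -> (forall j, g j.+1 = u * g j + g' j.+1) ->
  conv h g b F x - u * conv h g b F (x - b) = conv h g' b F x.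
Proof.
move=> hb hF g0 gS.
rewrite !(@conv_widen _ _ _ _ _ _ _ x (Num.truncn (h x)).+2) //.
rewrite (@conv_widen _ _ _ _ _ _ _ (x - b) (Num.truncn (h x)).+1) //; last first.
  by rewrite ltnS -[b in x - b]mulr1n truncn_height_shift.
rewrite big_ord_recl [RHS]big_ord_recl /= g0 -addrA; congr (_ + _).
rewrite mulr_sumr -sumrB; apply: eq_bigr => j _ /=.
by rewrite gS mulrDl mulrS opprD addrA mulrA [LHS]addrAC subrr add0r.
Qed.

(** Equal twisted differences make [F - F'] at [x] equal to [u ^+ j] times its value at
    [x - b *+ j]; for [j > h x] both functions vanish there. *)
Lemma twdiff_inj (u : A) b F F' : 1 <= h b ->
  height_supported h F -> height_supported h F' ->
  (forall x, F x - u * F (x - b) = F' x - u * F' (x - b)) -> F =1 F'.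
Proof.
move=> hb hF hF' E x; apply/eqP; rewrite -subr_eq0; apply/eqP.
have iterE j : F x - F' x = u ^+ j * (F (x - b *+ j) - F' (x - b *+ j)).
  elim: j => [|j ->]; first by rewrite mulr0n subr0 mul1r.
  rewrite exprSr -mulrA; congr (_ * _); rewrite mulrSr opprD addrA mulrBr.
  set z := x - b *+ j; have /eqP := E z; rewrite -subr_eq0 => /eqP Ez.
  by apply/eqP; rewrite -subr_eq0; apply/eqP; rewrite -[RHS]Ez; ring.
pose j := (Num.truncn (h x)).+1.
have supp0 G : height_supported h G -> G (x - b *+ j) = 0.
  move=> hG; have [//|/hG] := eqVneq (G (x - b *+ j)) 0.
  rewrite raddfB raddfMn subr_ge0 leNgt => /negP[].
  by apply: lt_le_trans (truncnS_gt _) _; rewrite lerMn2r hb orbT.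
by rewrite (iterE j) !supp0 // subrr mulr0.
Qed.

(** The coefficient of [z^j] in [(1 - u z)^-(m+1)]. *)
Definition binomial_weight (u : A) m j := u ^+ j * 'C(j + m, m)%:R.

(** By Pascal's rule and induction on [m] both sides have the same twisted difference, so
    [twdiff_inj] applies. *)
Lemma iter_conv_geometric u m b F : 1 <= h b -> height_supported h F ->
  iter m.+1 (conv h (GRing.exp u) b) F =1 conv h (binomial_weight u m) b F.
Proof.
move=> hb hF; elim: m => [|m IH].
  by move=> x; apply: eq_bigr => j _; rewrite /binomial_weight addn0 bin0 mulr1.
have hs k : height_supported h (iter k (conv h (GRing.exp u) b) F).
  by elim: k => //= k; apply: conv_supported.
apply: (twdiff_inj (u := u) hb); [exact: hs|exact: conv_supported|] => x.
rewrite iterS conv_geometric // IH; apply/esym/conv_twdiff => // [|j].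
  by rewrite /binomial_weight !binn.
rewrite /binomial_weight mulrA -exprS -mulrDr; congr (_ * _).
by rewrite -natrD addSn -addSnnS binS addSnnS.
Qed.

(** This trades binomial weights for a longer sequence of vectors with purely exponential
    weights. *)
Lemma iter_conv_multiplicity (T : eqType) (u : T -> A) (m : T -> nat) (b : T -> W) l :
  (forall k, 1 <= h (b k)) ->
  iter_conv h (fun k => GRing.exp (u k)) b (flatten [seq nseq (m k).+1 k | k <- l]) =1
  iter_conv h (fun k => binomial_weight (u k) (m k)) b l.
Proof.
move=> hb; elim: l => [//|k l IH] x.
have nseqE n F : foldr (fun i => conv h (GRing.exp (u i)) (b i)) F (nseq n k) =
    iter n (conv h (GRing.exp (u k)) (b k)) F by elim: n => //= n ->.
rewrite /iter_conv -[flatten _]/(nseq (m k).+1 k ++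
  flatten [seq nseq (m k).+1 k | k <- l]).
rewrite foldr_cat nseqE iter_conv_geometric //; last exact: iter_conv_supported.
exact: eq_conv.
Qed.

Lemma iter_conv_map (S T : eqType) (f : S -> T) (g : T -> nat -> A) (b : T -> W) l :
  iter_conv h (g \o f) (b \o f) l = iter_conv h g b (map f l).
Proof. by elim: l => //= k l ->. Qed.

(** Heights bound the relevant coordinates by [B], and coordinates outside [l] are pinned to 0; the
    index type thus stays the same throughout the induction on [l]. *)
Lemma iter_conv_sum (T : finType) (g : T -> nat -> A) (b : T -> W) (l : seq T) B x :
  (forall k, 1 <= h (b k)) -> uniq l -> (Num.truncn (h x) <= B)%N ->
  iter_conv h g b l x =
  \sum_(xi : {ffun T -> 'I_B.+1} | \sum_k b k *+ xi k == x)
     \prod_k (if k \in l then g k (xi k) else (xi k == ord0)%:R).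
Proof.
move=> hb; elim: l x => [|k l IH] x /=.
  move=> _ _; pose z : {ffun T -> 'I_B.+1} := [ffun=> ord0].
  have z_sum : \sum_k b k *+ z k = 0.
    by rewrite big1 // => k _; rewrite ffunE mulr0n.
  have z_prod : \prod_k (z k == ord0)%:R = 1 :> A.
    by rewrite big1 // => k _; rewrite ffunE eqxx.
  rewrite big_mkcond (bigD1 z) //= z_sum z_prod [X in _ = _ + X]big1 ?addr0.
    by rewrite /delta0 eq_sym; case: eqP.
  move=> xi xi0; case: ifP => // _.
  have [k xik] : exists k, xi k != ord0.
    have [/existsP //|] := boolP [exists k, xi k != ord0].
    rewrite negb_exists => /forallP xi0'; case/eqP: xi0; apply/ffunP => k.
    by rewrite ffunE; have := xi0' k; rewrite negbK => /eqP.
  by rewrite (bigD1 k) //= (negbTE xik) mul0r.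
move=> /andP[kl ul] xB; rewrite (@conv_widen _ _ _ _ _ _ _ _ B.+1) //; last first.
  exact: iter_conv_supported.
(* The points are sorted by their [k]-th coordinate [j]; [upd] then exchanges a [k]-th coordinate 0
   for [j]. *)
rewrite (partition_big (fun xi : {ffun T -> 'I_B.+1} => xi k) xpredT) //=.
apply: eq_bigr => j _; rewrite IH //; last first.
  by apply: leq_trans xB; apply: truncn_height_shift.
pose upd (i : 'I_B.+1) (xi : {ffun T -> 'I_B.+1}) :=
  [ffun l => if l == k then i else xi l].
rewrite (bigID (fun xi : {ffun T -> 'I_B.+1} => xi k == ord0)) /=.
rewrite [X in _ * (_ + X)]big1 ?addr0; last first.
  move=> xi /andP[_ xik]; rewrite (bigD1 k) //= (negbTE kl) (negbTE xik) mul0r //.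
rewrite mulr_sumr [RHS](reindex_onto (upd j) (upd ord0)) /=; last first.
  by move=> xi /andP[_ /eqP xik]; apply/ffunP => i; rewrite !ffunE; case: eqP => // ->.
apply: eq_big => [xi|xi /andP[_ /eqP xik]].
  have [xik|xik] := eqVneq (xi k) ord0; last first.
    rewrite andbF; apply/esym/andP => -[_ /eqP/ffunP/(_ k)].
    by rewrite !ffunE eqxx => xik0; rewrite -xik0 eqxx in xik.
  have -> : upd ord0 (upd j xi) = xi.
    by apply/ffunP => i; rewrite !ffunE; case: eqP => // ->.
  rewrite eqxx !andbT ffunE !eqxx andbT eq_sym subr_eq eq_sym; congr (_ == _).
  rewrite (bigD1 k) //= [in RHS](bigD1 k) //= xik mulr0n add0r ffunE eqxx addrC.
  by congr (_ + _); apply: eq_bigr => i /negbTE ik; rewrite ffunE ik.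
rewrite (bigD1 k) //= [RHS](bigD1 k) //= (negbTE kl) xik eqxx mul1r.
rewrite in_cons eqxx !ffunE eqxx; congr (_ * _); apply: eq_bigr => i /negbTE ik.
by rewrite in_cons ik ffunE ik.
Qed.
End Multiplicities.

(** * Bases extracted from a finite family *)

Section IndexedBases.
Variables (R : realFieldType) (W : vectType R) (T : finType) (b : T -> W).
Implicit Types (I J : {set T}) (t : T -> R).

Definition vecs I : #|I|.-tuple W := map_tuple b (enum_tuple I).

Definition is_basis I := basis_of fullv (vecs I).

(** The coordinate along [b k], for any [k] in [T]: the sum has one term if [k] is in [I] and is
    empty otherwise, so coordinates outside [I] are 0. *)
Definition co I k (x : W) : R :=
  \sum_(j < #|I| | enum_val j == k) coord (vecs I) j x.

Lemma co_is_linear I k : linear (co I k : W -> R^o).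
Proof.
move=> a x y; rewrite /co scaler_sumr -big_split /=.
by apply: eq_bigr => j _; rewrite linearP.
Qed.
HB.instance Definition _ I k :=
  GRing.isLinear.Build R W R^o _ (co I k) (co_is_linear I k).

Lemma vecs_nth I (j : 'I_#|I|) : (vecs I)`_j = b (enum_val j).
Proof.
rewrite /= (nth_map (enum_default j)) -?cardE //.
Qed.

Lemma sum_vecs I t : (forall k, k \notin I -> t k = 0) ->
  \sum_k t k *: b k = \sum_(j < #|I|) t (enum_val j) *: (vecs I)`_j.
Proof.
move=> t0; rewrite (bigID (mem I)) /= [X in _ + X]big1 ?addr0; last first.
  by move=> k /t0 ->; rewrite scale0r.
by rewrite big_enum_val; apply: eq_bigr => j _; rewrite vecs_nth.
Qed.

Lemma co_notin I k x : k \notin I -> co I k x = 0.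
Proof.
move=> kI; rewrite /co big_pred0 // => j; apply: contraNF kI => /eqP <-.
exact: enum_valP.
Qed.

Lemma co_enum_val I j x : co I (enum_val j) x = coord (vecs I) j x.
Proof.
by rewrite /co (big_pred1 j) // => i /=; rewrite (inj_eq enum_val_inj).
Qed.

Lemma co_sum I t k : free (vecs I) -> (forall k, k \notin I -> t k = 0) ->
  co I k (\sum_k t k *: b k) = t k.
Proof.
move=> fI t0; have [kI|kI] := boolP (k \in I); last by rewrite co_notin ?t0.
rewrite (sum_vecs t0) -(enum_rankK_in kI kI) co_enum_val.
exact: (coord_sum_free (fun j => t (enum_val j))).
Qed.

Lemma co_expand I x : is_basis I -> x = \sum_k co I k x *: b k.
Proof.
move=> bI; rewrite (sum_vecs (I := I)); last by move=> k; apply: co_notin.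
under eq_bigr do rewrite co_enum_val.
by rewrite -(coord_basis bI) // memvf.
Qed.

Lemma free_vecs_relation I : (forall t, (forall k, k \notin I -> t k = 0) ->
   \sum_k t k *: b k = 0 -> forall k, t k = 0) -> free (vecs I).
Proof.
move=> H; apply/freeP => r r0 j.
pose t k := \sum_(j < #|I| | enum_val j == k) r j.
have tE i : t (enum_val i) = r i.
  by rewrite /t (big_pred1 i) // => l /=; rewrite (inj_eq enum_val_inj).
have t0 k : k \notin I -> t k = 0.
  move=> kI; rewrite /t big_pred0 // => l; apply: contraNF kI => /eqP <-.
  exact: enum_valP.
by rewrite -tE (H t t0) // (sum_vecs t0) -[RHS]r0; apply: eq_bigr => i _; rewrite tE.
Qed.

Hypothesis b_span : forall x, exists t, x = \sum_k t k *: b k.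

Lemma basis_extend J : free (vecs J) -> exists2 I, is_basis I & J \subset I.
Proof.
move=> fJ; have [I /maxsetP[fI maxI] JI] :=
  maxset_exists (P := fun I => free (vecs I)) fJ.
exists I => //; rewrite /is_basis basisEdim.
suff sub : (fullv <= <<vecs I>>)%VS.
  by rewrite sub -(eqP fI) dimvS ?subvf.
have bk k : b k \in <<vecs I>>%VS.
  have [kI|kI] := boolP (k \in I).
    by rewrite memv_span //= map_f // mem_enum.
  apply: contraNT kI => kI; rewrite -(maxI (k |: I)) ?finset.setU11 ?finset.subsetU1 //.
  have perm : perm_eq (enum (k |: I)) (k :: enum I).
    apply: uniq_perm; rewrite /= ?enum_uniq // ?mem_enum.
      by rewrite andbT; apply: contraNN kI => kI; rewrite memv_span //= map_f // mem_enum.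
    by move=> i; rewrite inE !mem_enum !inE.
  by rewrite (perm_free (perm_map b perm)) /= free_cons kI.
apply/subvP => x _; have [t ->] := b_span x.
by apply: memv_suml => k _; apply: memvZ.
Qed.

(** While the vectors with nonzero coefficient are dependent, subtracting a multiple of a relation
    kills one coefficient and keeps the others nonnegative. Once free, they extend to a basis; it
    may leave [J], but the coordinates there are 0. *)
Lemma caratheodory J t : (forall k, 0 <= t k) -> (forall k, k \notin J -> t k = 0) ->
  exists2 I, is_basis I & forall k, 0 <= co I k (\sum_k t k *: b k) /\
    (k \notin J -> co I k (\sum_k t k *: b k) = 0).
Proof.
have [m] := ubnP #|[set k | t k != 0]|; elim: m t => // m IH t tm t0 tJ.
pose S := [set k | t k != 0].
have tS k : k \notin S -> t k = 0 by rewrite inE negbK => /eqP.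
have [fS|nfS] := boolP (free (vecs S)).
  have [I bI SI] := basis_extend fS; exists I => // k.
  rewrite co_sum ?(basis_free bI) //; first by split => // /tJ.
  by move=> i iI; apply: tS; apply: contra iI; apply/fintype.subsetP.
have [r [r0 rS [k rk]]] : exists r : T -> R, [/\ \sum_k r k *: b k = 0,
    forall k, k \notin S -> r k = 0 & exists k, 0 < r k].
  have [t' [t'S t'0 [k tk]]] : exists t', [/\ forall k, k \notin S -> t' k = 0,
      \sum_k t' k *: b k = 0 & exists k, t' k != 0].
    apply: contrapT => H; case/negP: nfS; apply: free_vecs_relation => t' t'S t'0 k.
    by apply/eqP; apply: contrapT => /negP tk; apply: H; exists t'; split=> //; exists k.
  (* A relation may be negated, so some coefficient can be taken positive. *)
  have [tk0|tk0] := ltP 0 (t' k); first by exists t'; split => //; exists k.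
  exists (fun i => - t' i); split.
  - by under eq_bigr do rewrite scaleNr; rewrite sumrN t'0 oppr0.
  - by move=> i /t'S ->; rewrite oppr0.
  - by exists k; rewrite oppr_gt0 lt_neqAle tk.
(* The least ratio [t k / r k] over [0 < r k] is the largest [th] that keeps [t - th * r]
   nonnegative. *)
have [k0 rk0 mink] := arg_minP (P := fun k => 0 < r k) (fun k => t k / r k) rk.
set th := t k0 / r k0 in mink.
have tk0_gt0 : 0 < t k0.
  rewrite lt_neqAle eq_sym t0 andbT; apply: contraTN rk0 => /eqP tk.
  by rewrite rS ?ltxx // inE tk eqxx.
pose t' k := t k - th * r k.
have -> : \sum_k t k *: b k = \sum_k t' k *: b k.
  under [RHS]eq_bigr do rewrite scalerBl -scalerA.
  by rewrite sumrB -scaler_sumr r0 scaler0 subr0.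
have t'S k1 : t' k1 != 0 -> k1 \in S.
  apply: contraNT => kS; by rewrite /t' rS // tS // mulr0 subr0.
apply: IH.
- apply: leq_trans (_ : #|S| <= m)%N; last by rewrite -ltnS.
  apply: proper_card; apply/properP; split.
    by apply/fintype.subsetP => i; rewrite inE => /t'S.
  exists k0; first by rewrite inE gt_eqF.
  by rewrite inE negbK /t' /th divfK ?subrr // gt_eqF.
- move=> i; rewrite /t' subr_ge0; have [ri|ri] := ltP 0 (r i).
    by rewrite -ler_pdivlMr // mink.
  by rewrite (le_trans _ (t0 i)) // mulr_ge0_le0 // divr_ge0 // ltW.
- move=> i iJ; apply: contraNeq iJ => /t'S; rewrite inE.
  by apply: contraNT => /tJ ->.
Qed.
End IndexedBases.

(** * Partition sums on a chamber *)

Section ChamberFormula.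
Variables (R : archiRealFieldType) (W : vectType R) (A : comNzRingType).
Variables (T : finType) (b : T -> W) (h : {additive W -> R}).
Hypothesis hb : forall k, 1 <= h (b k).
Hypothesis b_span : forall x, exists t : T -> R, x = \sum_k t k *: b k.
Variable chi : (T -> R) -> A.
Hypothesis chiD : forall s t, chi (fun k => s k + t k) = chi s * chi t.
Hypothesis chi0 : chi (fun=> 0) = 1.
Implicit Types (I J : {set T}) (t s : T -> R) (F : W -> A) (x y : W) (k : T).

Local Notation co := (co b).
Local Notation is_basis := (is_basis b).

Definition unit_vec k : T -> R := fun i => (i == k)%:R.
Definition weight k := chi (unit_vec k).

Lemma sum_unit_vec k : \sum_i unit_vec k i *: b i = b k.
Proof.
rewrite (bigD1 k) //= /unit_vec eqxx scale1r big1 ?addr0 // => i /negbTE ->.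
by rewrite scale0r.
Qed.

Definition psum J := iter_conv h (fun k => GRing.exp (weight k)) b (enum J).

Definition twdiff k F x := F x - weight k * F (x - b k).

Lemma psum_diff J k x : k \in J -> twdiff k (psum J) x = psum (J :\ k) x.
Proof.
move=> kJ; have e : psum J =1
    conv h (GRing.exp (weight k)) (b k) (psum (J :\ k)).
  move=> y; rewrite /psum (iter_conv_rem _ hb (k := k)) ?mem_enum //.
  apply: eq_conv => z; congr (iter_conv _ _ _ _ z).
  rewrite rem_filter ?enum_uniq // /enum_mem -filter_predI.
  by apply: eq_filter => i; rewrite /= !inE.
by rewrite /twdiff !e conv_geometric //; apply: iter_conv_supported.
Qed.

Lemma psum_combination J x : psum J x != 0 ->
  exists2 m : T -> nat, forall k, k \notin J -> m k = 0%N &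
    x = \sum_k (m k)%:R *: b k.
Proof.
move=> /(iter_conv_combination (enum_uniq _)) [m m0 ->]; exists m.
  by move=> k kJ; rewrite m0 // mem_enum.
by apply: eq_bigr => k _; rewrite scaler_nat.
Qed.

Lemma psum0 J : psum J 0 = 1.
Proof.
rewrite /psum; elim: (enum J) => [|k s IH] /=; first by rewrite /delta0 eqxx.
by rewrite /conv raddf0 truncn0 big_ord1 mulr0n subr0 expr0 mul1r.
Qed.

(** If [m k != 0], the sum over [J :\ k] vanishes at [x], whose coordinate along [b k] is nonzero;
    [psum_diff] then removes one copy of [b k] at the price of a factor [weight k]. *)
Lemma psum_free J (m : T -> nat) : free (vecs b J) ->
  (forall k, k \notin J -> m k = 0%N) ->
  psum J (\sum_k (m k)%:R *: b k) = chi (fun k => (m k)%:R).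
Proof.
move=> fJ; have [n] := ubnP (\sum_k m k)%N; elim: n m => // n IH m mn mJ.
have [/existsP[k mk]|] := boolP [exists k, m k != 0%N]; last first.
  rewrite negb_exists => /forallP m0.
  have {}m0 k : (m k)%:R = 0 :> R by have := m0 k; rewrite negbK => /eqP ->.
  rewrite big1 ?psum0; last by move=> k _; rewrite m0 scale0r.
  by under eq_fun do rewrite m0.
have kJ : k \in J by apply: contraNT mk => /mJ ->.
set x := \sum_k _.
have S0 : psum (J :\ k) x = 0.
  apply: contraNeq mk => /psum_combination[m' m'0 xE].
  have cx : co J k x = (m k)%:R by rewrite co_sum // => i /mJ ->.
  have : co J k x = (m' k)%:R.
    by rewrite xE co_sum // => i iJ; rewrite m'0 // !inE negb_and iJ orbT.
  by rewrite cx m'0 ?inE ?eqxx // => /eqP; rewrite eqr_nat.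
pose m' i := (m i - (i == k))%N.
have m'E i : m i = (m' i + (i == k))%N.
  by rewrite /m'; case: eqP => [->|]; rewrite ?subn0 ?addn0 // subnK // lt0n.
have := psum_diff x kJ; rewrite S0 /twdiff => /eqP; rewrite subr_eq0 => /eqP ->.
have -> : x - b k = \sum_k (m' k)%:R *: b k.
  apply/eqP; rewrite subr_eq; apply/eqP; rewrite /x.
  under eq_bigr do rewrite m'E natrD scalerDl.
  rewrite big_split /=; congr (_ + _).
  rewrite (bigD1 k) //= eqxx scale1r big1 ?addr0 // => i /negbTE ->.
  by rewrite scale0r.
rewrite IH.
- rewrite /weight -chiD; congr chi; apply/funext => i.
  by rewrite [in RHS]m'E natrD addrC.
- rewrite -ltnS; apply: leq_trans mn; rewrite ltnS.
  rewrite (bigD1 k) //= [ltnRHS](bigD1 k) //= -addSn; apply: leq_add.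
    by rewrite [X in (_ < X)%N]m'E eqxx addn1.
  by apply: leq_sum => i _; rewrite leq_subr.
- by move=> i /mJ mi; rewrite /m' mi.
Qed.

(** The character [chi] on the lattice generated by the basis [I], extended by 0. *)
Definition lattice_char I x : A :=
  if [forall k, co I k x \is a Num.int] then chi (fun k => co I k x) else 0.

(** A step by [b k] does not change membership in the lattice and changes [chi] by the factor
    [weight k]. *)
Lemma lattice_char_diff I k x : is_basis I -> k \in I ->
  twdiff k (lattice_char I) x = 0.
Proof.
move=> bI kI; have cE i : co I i (x - b k) = co I i x - unit_vec k i.
  rewrite linearB /=; congr (_ - _).
  rewrite -{1}(sum_unit_vec k) co_sum ?(basis_free bI) // => j jI; rewrite /unit_vec.
  by case: eqP jI => // ->; rewrite kI.
rewrite /twdiff /lattice_char.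
have -> : [forall i, co I i (x - b k) \is a Num.int] =
          [forall i, co I i x \is a Num.int].
  apply: eq_forallb => i; rewrite cE /unit_vec.
  by rewrite rpredBr // rpred_nat.
case: ifP => _; last by rewrite mulr0 subrr.
rewrite /weight -chiD; apply/eqP; rewrite subr_eq0; apply/eqP; congr chi.
by apply/funext => i; rewrite cE addrC subrK.
Qed.

Variable BB : {set {set T}}.
Hypothesis BB_basis : forall I, I \in BB -> is_basis I.

(* [BB] stands for the set of bases whose cone contains the chamber; the set
   below is an open cone containing the chamber. *)
Definition in_chamber x := forall I, is_basis I ->
  if I \in BB then forall k, k \in I -> 0 < co I k x
  else exists2 k, k \in I & co I k x < 0.

Definition live J := [exists I in BB, I \subset J].

Lemma live_sub J J' : J \subset J' -> live J -> live J'.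
Proof.
move=> sJ /exists_inP[I IB IJ]; apply/exists_inP; exists I => //.
exact: fintype.subset_trans sJ.
Qed.

(* A cone element x - t puts x in the cone of J, and then by Caratheodory in the
   cone of a basis contained in J. *)
Lemma psum_dead J x t : ~~ live J -> in_chamber x -> (forall k, 0 <= t k) ->
  (forall k, k \notin J -> t k = 0) -> psum J (x - \sum_k t k *: b k) = 0.
Proof.
move=> dJ cx t0 tJ; apply: contraNeq dJ => /psum_combination[m mJ xE].
have [|k kJ|I bI coI] := caratheodory b_span (J := J) (t := fun k => t k + (m k)%:R).
- by move=> k; rewrite addr_ge0.
- by rewrite tJ // mJ // addr0.
have {}coI k : 0 <= co I k x /\ (k \notin J -> co I k x = 0).
  suff -> : x = \sum_k (t k + (m k)%:R) *: b k by [].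
  rewrite -[LHS](subrK (\sum_k t k *: b k)) xE -big_split /=.
  by apply: eq_bigr => i _; rewrite addrC scalerDl.
have := cx I bI; case: ifP => [IB pos|_ [k kI]]; last first.
  by rewrite ltNge (coI k).1.
apply/exists_inP; exists I => //; apply/fintype.subsetP => k kI.
by apply: contraLR (pos k kI) => /(coI k).2 ->; rewrite ltxx.
Qed.

Lemma int_gtN1_nat (z : R) : z \is a Num.int -> -1 < z -> exists m : nat, z = m%:R.
Proof.
move=> /intrP[[m|m] ->]; first by exists m.
by rewrite NegzE mulrNz ltrN2 ltrn1.
Qed.

(** The coordinates of [x] are positive and a box point lowers them by at most 1, so they stay above
    -1. An integer above -1 is natural: integral coordinates are then those of a point of the
    semigroup generated by the basis. *)
Lemma psum_basis I x t : I \in BB -> in_chamber x ->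
  (forall k, 0 <= t k <= 1) -> (forall k, k \notin I -> t k = 0) ->
  psum I (x - \sum_k t k *: b k) = lattice_char I (x - \sum_k t k *: b k).
Proof.
move=> IB cx t01 tI; have bI := BB_basis IB; have fI := basis_free bI.
set z := x - _.
have z1 k : -1 < co I k z.
  have [kI|kI] := boolP (k \in I); last by rewrite co_notin // ltrN10.
  rewrite /z linearB /= co_sum // ltrBrDl.
  have := cx I bI; rewrite IB => /(_ k kI); have /andP[_] := t01 k.
  by rewrite -subr_le0 => ? ?; apply: le_lt_trans _ _; last eassumption.
rewrite /lattice_char; case: ifPn => [/forallP zint|].
  have [m mE] := choice (fun k => int_gtN1_nat (zint k) (z1 k)).
  rewrite [in LHS](co_expand z bI).
  under eq_bigr do rewrite mE.
  rewrite psum_free //; last first.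
    move=> k kI; apply/eqP; rewrite -(eqr_nat R) -mE co_notin //.
  by congr chi; apply/funext => k; rewrite mE.
apply: contraNeq => /psum_combination[m mI zE]; apply/forallP => k.
by rewrite zE co_sum ?rpred_nat // => i /mI ->.
Qed.

(** * Integer relations as combinations of difference operators *)

Variable L : W -> Prop.
Hypothesis L0 : L 0.
Hypothesis LD : forall x k, L x -> L (x + b k).
Hypothesis LB : forall x k, L x -> L (x - b k).

Definition shift_comb (q : seq (A * W)) F x := \sum_(p <- q) p.1 * F (x - p.2).

(* The shifts (chi a, sum_k a_k b_k) for which 1 - A^a lies in the ideal generated
   by the [twdiff k], k in J. *)
Definition loops J (a : T -> int) :=
  L (\sum_k b k *~ a k) /\
  exists2 q : T -> seq (A * W), forall k p, p \in q k -> L p.2 &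
  forall F x, F x - chi (fun k => (a k)%:~R) * F (x - \sum_k b k *~ a k) =
    \sum_(k in J) shift_comb (q k) (twdiff k F) x.

Lemma loops0 J : loops J (fun=> 0).
Proof.
have s0 : \sum_k b k *~ (fun=> 0 : int) k = 0.
  by rewrite big1 // => k _; rewrite mulr0z.
split; first by rewrite s0.
exists (fun=> [::]) => // F x; rewrite s0 subr0.
by rewrite chi0 mul1r subrr big1 // => k _; rewrite /shift_comb big_nil.
Qed.

Lemma sum_add_unit (a : T -> int) k (z : int) :
  \sum_i b i *~ (a i + z *+ (i == k)) = \sum_i b i *~ a i + b k *~ z.
Proof.
under eq_bigr do rewrite mulrzDr; rewrite big_split /=; congr (_ + _).
rewrite (bigD1 k) //= eqxx big1 ?addr0 // => i /negbTE ->.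
by rewrite mulr0n mulr0z.
Qed.

Lemma shift_comb_sum_cons J (q : T -> seq (A * W)) k c F x : k \in J ->
  \sum_(i in J) shift_comb (if i == k then c :: q i else q i) (twdiff i F) x =
  \sum_(i in J) shift_comb (q i) (twdiff i F) x + c.1 * twdiff k F (x - c.2).
Proof.
move=> kJ; rewrite (bigD1 k) //= [in RHS](bigD1 k) //= eqxx.
rewrite {1}/shift_comb big_cons -/(shift_comb _ _ _) [RHS]addrAC.
congr (_ + _); first by rewrite addrC.
by apply: eq_bigr => i /andP[_ /negbTE ->].
Qed.

(** [1 - A^a A_k = (1 - A^a) + A^a (1 - A_k)]. *)
Lemma loops_add J (a : T -> int) k : k \in J -> loops J a ->
  loops J (fun i => a i + 1 *+ (i == k)).
Proof.
move=> kJ [La [q qL qE]]; rewrite /loops sum_add_unit mulr1z; split; first exact: LD.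
exists (fun i => if i == k then
    (chi (fun i => (a i)%:~R), \sum_i b i *~ a i) :: q i else q i).
  by move=> i p; case: ifP => _; [rewrite inE => /predU1P[->//|]|]; apply: qL.
move=> F x; rewrite shift_comb_sum_cons // -qE /twdiff /=.
have -> : chi (fun i => (a i + 1 *+ (i == k))%:~R) =
    chi (fun i => (a i)%:~R) * weight k.
  by rewrite -chiD; congr chi; apply/funext => i; rewrite intrD rmorphMn.
by rewrite opprD addrA; ring.
Qed.

(** [1 - A^a A_k^-1 = (1 - A^a) - A^a A_k^-1 (1 - A_k)]. *)
Lemma loops_sub J (a : T -> int) k : k \in J -> loops J a ->
  loops J (fun i => a i + (-1) *+ (i == k)).
Proof.
move=> kJ [La [q qL qE]]; rewrite /loops sum_add_unit mulrN1z; split; first exact: LB.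
set w := chi (fun i => _).
exists (fun i => if i == k then (- w, \sum_i b i *~ a i - b k) :: q i else q i).
  move=> i p; case: ifP => _; [rewrite inE => /predU1P[->|]|]; try exact: qL.
  exact: LB.
move=> F x; rewrite shift_comb_sum_cons // -qE /twdiff /=.
have -> : chi (fun i => (a i)%:~R) = w * weight k.
  rewrite -chiD; congr chi; apply/funext => i; rewrite intrD rmorphMn /=.
  by rewrite mulrNz mulNrn -addrA addNr addr0.
have -> : x - (\sum_i b i *~ a i - b k) - b k = x - \sum_i b i *~ a i.
  by rewrite opprB addrA addrAC addrK.
by ring.
Qed.

(** [a] is built up one index of [J] at a time and, at each index, by unit steps. *)
Lemma loops_all J (a : T -> int) : (forall k, k \notin J -> a k = 0) -> loops J a.
Proof.
move=> aJ; pose c (l : seq T) i := if i \in l then a i else 0.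
have -> : a = c (enum J).
  by apply/funext => i; rewrite /c mem_enum; case: ifPn => // /aJ.
have : {subset enum J <= J} by move=> i; rewrite mem_enum.
elim: (enum J) (enum_uniq J) => [_ _|k l IH /= /andP[ks us] sJ].
  exact: loops0.
have kJ : k \in J by rewrite sJ ?mem_head.
have {IH} ls : loops J (c l) by apply: IH => // i si; rewrite sJ // inE si orbT.
have -> : c (k :: l) = fun i => c l i + a k *+ (i == k).
  apply/funext => i; rewrite /c inE; case: eqVneq => [->|_] /=.
    by rewrite (negbTE ks) add0r.
  by rewrite mulr0n addr0.
elim/int_rec: (a k) => [|n IH|n IH].
- by under eq_fun do rewrite mul0rn addr0.
- have -> : (fun i => c l i + n.+1%:Z *+ (i == k)) =
     fun i => (c l i + n%:Z *+ (i == k)) + 1 *+ (i == k).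
    by apply/funext => i; rewrite -addrA -mulrnDl intS [1 + _]addrC.
  exact: loops_add.
- have -> : (fun i => c l i + (- n.+1%:Z) *+ (i == k)) =
     fun i => (c l i + (- n%:Z) *+ (i == k)) + (-1) *+ (i == k).
    by apply/funext => i; rewrite -addrA -mulrnDl intS opprD [-1 + _]addrC.
  exact: loops_sub.
Qed.

Variables (rel : {set T} -> T -> int) (e : A) (e' : {set T} -> A).
Hypothesis rel_supp : forall I J, is_basis I -> I \proper J ->
  forall k, k \notin J -> rel J k = 0.
Hypothesis rel_sum : forall I J, is_basis I -> I \proper J ->
  \sum_k b k *~ rel J k = 0.
Hypothesis e_factor : forall I J, is_basis I -> I \proper J ->
  e = e' J * (1 - chi (fun k => (rel J k)%:~R)).
Hypothesis e_regular : forall z, e * z = 0 -> z = 0.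

(** The total displacement of a relation is 0, so [1 - A^r] is multiplication by the scalar
    [1 - u^r]. The operators depend on [J] alone, not on the basis inside it. *)
Lemma relation_operators : exists ops : {set T} -> T -> seq (A * W),
  forall I J, is_basis I -> I \proper J ->
    (forall k p, p \in ops J k -> L p.2) /\
    (forall F x, (1 - chi (fun k => (rel J k)%:~R)) * F x =
       \sum_(k in J) shift_comb (ops J k) (twdiff k F) x).
Proof.
suff /choice[ops H] : forall J, exists q : T -> seq (A * W),
    forall I, is_basis I -> I \proper J ->
    (forall k p, p \in q k -> L p.2) /\
    (forall F x, (1 - chi (fun k => (rel J k)%:~R)) * F x =
       \sum_(k in J) shift_comb (q k) (twdiff k F) x).
  by exists ops => I J; apply: H.
move=> J.
have [[I [bI IJ]]|H] := pselect (exists I, is_basis I /\ I \proper J).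
  have [_ [q qL qE]] := loops_all (rel_supp bI IJ).
  exists q => I' bI' IJ'; split=> // F x.
  by rewrite -qE (rel_sum bI IJ) subr0 mulrBl mul1r.
by exists (fun=> [::]) => I bI IJ; case: H; exists I.
Qed.

(** * Chamber functions by recursion on the subfamily *)

Variable ops : {set T} -> T -> seq (A * W).
Hypothesis ops_L : forall I J, is_basis I -> I \proper J ->
  forall k p, p \in ops J k -> L p.2.
Hypothesis opsE : forall I J, is_basis I -> I \proper J -> forall F x,
  (1 - chi (fun k => (rel J k)%:~R)) * F x =
       \sum_(k in J) shift_comb (ops J k) (twdiff k F) x.

(** With [m = #|J|] as fuel this is [e ^+ #|J|] times the function [P_J]: instead of dividing by
    [1 - u^r], each level multiplies by the cofactor [e' J], so that it suffices for [e] to be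
    regular. *)
Fixpoint chamber_rec m J x : A :=
  if ~~ live J then 0
  else if J \in BB then e ^+ #|J| * lattice_char J x
  else if m is m'.+1 then
    e' J * \sum_(k in J) shift_comb (ops J k) (chamber_rec m' (J :\ k)) x
  else 0.

Definition chamber_fun J := chamber_rec #|J| J.

Lemma chamber_fun_dead J x : ~~ live J -> chamber_fun J x = 0.
Proof. by rewrite /chamber_fun; case: #|J| => [|m] /= ->. Qed.

Lemma BB_live I : I \in BB -> live I.
Proof. by move=> IB; apply/exists_inP; exists I. Qed.

Lemma chamber_fun_basis J x : J \in BB ->
  chamber_fun J x = e ^+ #|J| * lattice_char J x.
Proof.
move=> JB; have lJ := BB_live JB.
by rewrite /chamber_fun; case: {1}#|J| => [|m] /=; rewrite lJ JB.
Qed.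

Lemma chamber_fun_rec J x : live J -> J \notin BB ->
  chamber_fun J x =
  e' J * \sum_(k in J) shift_comb (ops J k) (chamber_fun (J :\ k)) x.
Proof.
move=> lJ /negbTE JB; have [m mJ] : exists m, #|J| = m.+1.
  case mE : #|J| => [|m]; last by exists m.
  case/exists_inP: lJ => I IB; have -> : J = finset.set0 by apply: cards0_eq.
  by rewrite finset.subset0 => /eqP I0; move: JB; rewrite (cards0_eq mE) -I0 IB.
rewrite {1}/chamber_fun mJ /= lJ JB /=; congr (_ * _).
apply: eq_bigr => k kJ; congr (shift_comb _ _ x); rewrite /chamber_fun.
by have := cardsD1 k J; rewrite kJ mJ => -[->].
Qed.

Lemma live_proper J : live J -> J \notin BB ->
  exists I, [/\ I \in BB, is_basis I & I \proper J].
Proof.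
case/exists_inP=> I IB IJ JB; exists I; split=> //; first exact: BB_basis.
rewrite finset.properEneq IJ andbT; apply: contraNneq JB => <- //.
Qed.

Lemma BB_minimal J k : J \in BB -> k \in J -> ~~ live (J :\ k).
Proof.
move=> JB kJ; apply/negP => /exists_inP[I IB /subset_leq_card].
rewrite leqNgt => /negP[].
have := vector.size_basis (BB_basis IB); have := vector.size_basis (BB_basis JB).
by move=> -> <-; rewrite (cardsD1 k J) kJ.
Qed.

Lemma twdiff_shift_comb k q F x :
  twdiff k (shift_comb q F) x = shift_comb q (twdiff k F) x.
Proof.
rewrite /twdiff /shift_comb mulr_sumr -sumrB; apply: eq_bigr => p _.
by rewrite mulrBr mulrCA addrAC.
Qed.

Lemma eq_shift_comb q F F' x : F =1 F' -> shift_comb q F x = shift_comb q F' x.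
Proof. by move=> FE; apply: eq_bigr => p _; rewrite FE. Qed.

Lemma setD1C J j k : (J :\ k) :\ j = (J :\ j) :\ k.
Proof. by rewrite !finset.setDDl finset.setUC. Qed.

(** Expand [chamber_fun J] by its recursion on one side and [e] as [e' J * (1 - u^r)] on the other.
    The terms at the removed index coincide; at any other index, induction turns both terms into [e]
    times the function with both indices removed. *)
Lemma chamber_fun_diff J k x : k \in J ->
  twdiff k (chamber_fun J) x = e * chamber_fun (J :\ k) x.
Proof.
have [m] := ubnP #|J|; elim: m J k x => // m IH J j x Jm jJ.
have [lJ|dJ] := boolP (live J); last first.
  rewrite /twdiff !chamber_fun_dead ?mulr0 ?subr0 //.
  by apply: contraNN dJ; apply: live_sub; apply: finset.subsetDl.
have [JB|JB] := boolP (J \in BB).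
  rewrite /twdiff !(chamber_fun_basis _ JB) chamber_fun_dead ?BB_minimal //.
  have := lattice_char_diff x (BB_basis JB) jJ; rewrite /twdiff => dE.
  by rewrite mulrCA -mulrBr dE !mulr0.
have [I [_ bI IJ]] := live_proper lJ JB.
have smaller k : k \in J -> (#|J :\ k| < m)%N.
  by move=> kJ; move: Jm; rewrite (cardsD1 k J) kJ.
rewrite (e_factor bI IJ) -mulrA (opsE bI IJ).
rewrite {1}/twdiff !chamber_fun_rec // [weight _ * (_ * _)]mulrCA -mulrBr.
congr (_ * _); rewrite mulr_sumr -sumrB; apply: eq_bigr => k kJ.
rewrite -/(twdiff j (shift_comb (ops J k) (chamber_fun (J :\ k))) x).
rewrite twdiff_shift_comb; apply: eq_shift_comb => y.
have [->//|kj] := eqVneq k j.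
rewrite !IH ?smaller // ?inE ?kj ?(eq_sym j) ?kj //.
by rewrite setD1C.
Qed.

(** * Vanishing of the defect near the chamber *)

Definition defect J x := e ^+ #|J| * psum J x - chamber_fun J x.

Lemma defect_diff J k x : k \in J -> twdiff k (defect J) x = e * defect (J :\ k) x.
Proof.
move=> kJ; rewrite /defect mulrBr -chamber_fun_diff // -psum_diff //.
rewrite mulrA -exprS; have -> : #|J :\ k|.+1 = #|J| by rewrite (cardsD1 k J) kJ.
by rewrite /twdiff; ring.
Qed.

(** The coordinates that witness [in_chamber] grow linearly along the ray of [x], so a displacement
    with coordinates bounded by [M] finally cannot change their signs. *)
Lemma in_chamber_deep x (M : R) : in_chamber x -> exists2 C : R, 0 <= C &
  forall th y, C <= th -> (forall I k, `|co I k y| <= M) ->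
    in_chamber ((1 + th) *: x - y).
Proof.
move=> cx; have [M0|M0] := leP 0 M; last first.
  exists 0 => // th y _ yM; have [k _|T0] := pickP (fun k : T => true).
    by have := le_trans (normr_ge0 _) (yM finset.set0 k); rewrite leNgt M0.
  move=> I bI; case: ifP => IB; first by move=> k; have := T0 k.
  by have := cx I bI; rewrite IB => -[k]; have := T0 k.
(* This dominates every single ratio; a ratio with zero denominator reads 0. *)
pose C := \sum_(I : {set T}) \sum_k M / `|co I k x|.
have C_ge I k : M / `|co I k x| <= C.
  rewrite /C (bigD1 I) //= (bigD1 k) //= -addrA lerDl.
  by rewrite addr_ge0 ?sumr_ge0 // => *; rewrite ?sumr_ge0 // => *; rewrite divr_ge0.
exists C; first by rewrite sumr_ge0 // => *; rewrite sumr_ge0 // => *; rewrite divr_ge0.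
move=> th y Cth yM.
have thM I k : co I k x != 0 -> M <= th * `|co I k x|.
  by move=> c0; rewrite -ler_pdivrMr ?normr_gt0 // (le_trans (C_ge I k)).
have cE I k : co I k ((1 + th) *: x - y) = (1 + th) * co I k x - co I k y.
  by rewrite linearB linearZ.
move=> I bI; have := cx I bI; case: ifP => IB.
  move=> pos k kI; have c0 := pos k kI; rewrite cE.
  have := thM I k; rewrite gt_eqF // gtr0_norm // => /(_ isT).
  have := yM I k; rewrite ler_norml => /andP[_]; nra.
case=> k kI c0; exists k => //; rewrite cE.
have := thM I k; rewrite lt_eqF // ltr0_norm // => /(_ isT).
have := yM I k; rewrite ler_norml => /andP[+ _]; nra.
Qed.

Definition unit_box J t := (forall k, 0 <= t k <= 1) /\ (forall k, k \notin J -> t k = 0).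

Lemma in_chamber_ray x th : in_chamber x -> 0 <= th -> in_chamber ((1 + th) *: x).
Proof.
move=> cx th0 I bI; have := cx I bI; case: ifP => IB.
  by move=> pos k /pos c0; rewrite linearZ /= mulr_gt0 // ltr_wpDr.
by case=> k kI c0; exists k => //; rewrite linearZ /= pmulr_rlt0 // ltr_wpDr.
Qed.

Lemma weight_unit k z : weight k * z = 0 -> z = 0.
Proof.
move=> /(congr1 ( *%R (chi (fun i => - unit_vec k i)))).
rewrite mulr0 mulrA -chiD; under eq_fun do rewrite addNr.
by rewrite chi0 mul1r.
Qed.

(** An empty basis would force [b k = 0], against [1 <= h (b k)]. *)
Lemma basis_nonempty I J : is_basis I -> I \proper J -> exists k, k \in I.
Proof.
move=> bI /properP[_ [k _ _]]; have [I0|] := finset.set_0Vmem I;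
  last by case=> i; exists i.
have := hb k; rewrite (co_expand (b k) bI) big1 ?raddf0 ?ler10 //.
by move=> i _; rewrite co_notin ?scale0r // I0 inE.
Qed.

(* [n] counts the jumps; s k <= 1 forces th to tend to infinity with it. *)
Lemma defect_ray J I x t n : I \in BB -> I \proper J -> in_chamber x ->
  (forall k y s, k \in J -> in_chamber y -> unit_box (J :\ k) s ->
     defect (J :\ k) (y - \sum_i s i *: b i) = 0) ->
  unit_box J t -> exists th s, [/\ 0 <= th, unit_box J s,
    n%:R + \sum_k s k = \sum_k t k + th * \sum_k co I k x &
    defect J ((1 + th) *: x - \sum_k s k *: b k) = 0 ->
    defect J (x - \sum_k t k *: b k) = 0].
Proof.
move=> IB IJ cx sub tJ; have bI := BB_basis IB.
have pos k : k \in I -> 0 < co I k x by have := cx I bI; rewrite IB; apply.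
have co0 k : 0 <= co I k x.
  by have [/pos/ltW//|kI] := boolP (k \in I); rewrite co_notin.
elim: n => [|n [th [s [th0 [s01 sJ] sE sD]]]].
  by exists 0, t; split; rewrite // ?add0r ?mul0r ?addr0 // scale1r.
have [k0 k0I] := basis_nonempty bI IJ.
(* [k] is the index at which [s k + d * co I k x] first reaches 1, and [d] the time when it does. *)
have [k kI mink] := arg_minP (P := mem I) (fun k => (1 - s k) / co I k x) k0I.
set d := _ / _ in mink; have ck := pos k kI.
have sk i : s i <= 1 by case/andP: (s01 i).
have d0 : 0 <= d by rewrite divr_ge0 ?subr_ge0 // ltW.
pose s' i := s i + d * co I i x; pose s2 i := s' i - unit_vec k i.
have kJ : k \in J by apply: (fintype.subsetP (fintype.proper_sub IJ)).
have s'k : s' k = 1 by rewrite /s' /d divfK ?gt_eqF // addrC subrK.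
have s'01 i : 0 <= s' i <= 1.
  apply/andP; split; first by apply: addr_ge0; [case/andP: (s01 i)|apply: mulr_ge0].
  rewrite /s'.
  have [iI|iI] := boolP (i \in I); last by rewrite co_notin // mulr0 addr0.
  by rewrite -lerBrDl -ler_pdivlMr ?pos // mink.
have s2J : unit_box (J :\ k) s2.
  rewrite /s2 /unit_vec; split=> i; have [->|ik] := eqVneq i k.
  - by rewrite s'k subrr lexx ler01.
  - by rewrite subr0.
  - by rewrite s'k subrr.
  rewrite !inE ik /= => iJ; rewrite subr0 /s' sJ // add0r co_notin ?mulr0 //.
  by apply: contra iJ; move: i {ik}; apply/fintype.subsetP; exact: fintype.proper_sub.
have xd : d *: x = \sum_i (d * co I i x) *: b i.
  by rewrite {1}(co_expand x bI) scaler_sumr; apply: eq_bigr => i _; rewrite scalerA.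
(* Moving on by [d] along the ray and resetting the coefficient at [k] from 1 to 0 displaces the
   point by exactly [b k]. *)
have yE : (1 + (th + d)) *: x - \sum_i s2 i *: b i - b k =
    (1 + th) *: x - \sum_i s i *: b i.
  rewrite [1 + (_ + _)]addrA [(_ + d) *: x]scalerDl xd -[in LHS](sum_unit_vec k) -!addrA; congr (_ + _).
  rewrite -!sumrN -!big_split /=; apply: eq_bigr => i _.
  by rewrite -!scaleNr -!scalerDl; congr (_ *: _); rewrite /s2 /s'; ring.
exists (th + d), s2; split.
- exact: addr_ge0.
- split=> i; first exact: s2J.1.
  by move=> iJ; apply: s2J.2; rewrite !inE negb_and iJ orbT.
- rewrite mulrDl addrA -sE /s2 sumrB /s' big_split /= -mulr_sumr.
  have -> : \sum_i unit_vec k i = 1.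
    by rewrite (bigD1 k) //= /unit_vec eqxx big1 ?addr0 // => i /negbTE ->.
  by rewrite -natr1; ring.
(* The box coefficients at [y] live on [J :\ k], so the twisted difference of the defect vanishes at
   [y]. As [weight k] is a unit, a zero of the defect at [y] gives one at [y - b k]. *)
- set y := _ - _ => y0; apply: sD; rewrite -yE -/y.
  have := defect_diff y kJ; rewrite /twdiff y0 sub0r sub ?mulr0 //; last first.
    by apply: in_chamber_ray => //; apply: addr_ge0.
  by move/eqP; rewrite oppr_eq0 => /eqP /weight_unit.
Qed.

Lemma defect0 J x t : in_chamber x -> unit_box J t ->
  defect J (x - \sum_k t k *: b k) = 0.
Proof.
have [m] := ubnP #|J|; elim: m J x t => // m IH J x t Jm cx tJ.
have [lJ|dJ] := boolP (live J); last first.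
  rewrite /defect psum_dead ?mulr0 ?sub0r ?chamber_fun_dead ?oppr0 //.
    by move=> k; case/andP: (tJ.1 k).
  exact: tJ.2.
have [JB|JB] := boolP (J \in BB).
  by rewrite /defect chamber_fun_basis // psum_basis ?subrr //; case: tJ.
have [I [IB bI IJ]] := live_proper lJ JB.
have {}IH k y s : k \in J -> in_chamber y -> unit_box (J :\ k) s ->
    defect (J :\ k) (y - \sum_i s i *: b i) = 0.
  by move=> kJ; apply: IH; move: Jm; rewrite (cardsD1 k J) kJ.
(* Bounds the coordinates of the two displacements met below: a box point and a translation
   occurring in [ops J]. *)
pose M1 (i : {set T}) k := \sum_j `|co i k (b j)| +
   \sum_j \sum_(p <- ops J j) `|co i k p.2|.
have M1_ge0 i k : 0 <= M1 i k.
  by rewrite addr_ge0 // sumr_ge0 // => j _; rewrite sumr_ge0.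
pose M := \sum_(i : {set T}) \sum_k M1 i k.
have M1_le i k : M1 i k <= M.
  rewrite /M (bigD1 i) //= (bigD1 k) //= -addrA lerDl.
  by rewrite addr_ge0 ?sumr_ge0 // => j _; rewrite sumr_ge0.
have [C C0 deep] := in_chamber_deep M cx.
pose S := \sum_k co I k x.
have S0 : 0 < S.
  have pos k : k \in I -> 0 < co I k x by have := cx I bI; rewrite IB; apply.
  have [k kI] := basis_nonempty bI IJ.
  rewrite /S (bigD1 k) //= ltr_pwDl ?pos // sumr_ge0 // => i _.
  by have [/pos/ltW//|iI] := boolP (i \in I); rewrite co_notin.
(* Enough jumps to force [C <= th]: as the [s k] are nonnegative,
   [th * S >= n - \sum_k t k > C * S]. *)
pose n := (Num.truncn (\sum_k t k + C * S)).+1.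
have [th [s [th0 sJ sE sD]]] : exists th s, [/\ 0 <= th, unit_box J s,
    n%:R + \sum_k s k = \sum_k t k + th * \sum_k co I k x &
    defect J ((1 + th) *: x - \sum_k s k *: b k) = 0 ->
    defect J (x - \sum_k t k *: b k) = 0].
  apply: (defect_ray n IB IJ cx IH tJ).
have Cth : C <= th.
  rewrite -(ler_pM2r S0) -(lerD2l (\sum_k t k)) -sE ler_wpDr //.
    by rewrite sumr_ge0 // => k _; case/andP: (sJ.1 k).
  exact/ltW/truncnS_gt.
apply: sD; set z := _ - _.
(* The relation writes [e * defect J z] as a combination of translated differences of the defect,
   that is, of defects of the [J :\ k] at points still in the chamber, where they vanish by
   induction. *)
apply: (@e_regular); rewrite (e_factor bI IJ) -mulrA (opsE bI IJ) big1 ?mulr0 //.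
move=> k kJ; rewrite /shift_comb big_seq big1 // => p pq.
rewrite defect_diff //.
suff cp : in_chamber (z - p.2).
  have := IH k (z - p.2) (fun=> 0) kJ cp; rewrite big1 ?subr0 => [->|i _].
  - by rewrite !mulr0.
  - by split => // i; rewrite ?lexx ?ler01.
  - by rewrite scale0r.
rewrite /z -addrA -opprD; apply: deep => // i j.
apply: le_trans (M1_le i j).
rewrite linearD (le_trans (ler_normD _ _)) // lerD //.
  rewrite linear_sum (le_trans (ler_norm_sum _ _ _)) // ler_sum // => l _.
  rewrite linearZ normrM; case/andP: (sJ.1 l) => s0 s1.
  by rewrite ger0_norm // ler_piMl.
rewrite (bigD1 k) //= (big_rem p) //= -addrA lerDl addr_ge0 ?sumr_ge0 // => *.
by rewrite sumr_ge0.
Qed.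

(** * Stability of a class of functions under the recursion *)

Variable Cls : (W -> A) -> Prop.
Hypothesis Cls0 : Cls (fun=> 0).
Hypothesis ClsD : forall F G, Cls F -> Cls G -> Cls (fun x => F x + G x).
Hypothesis ClsZ : forall a F, Cls F -> Cls (fun x => a * F x).
Hypothesis Cls_shift : forall y F, L y -> Cls F -> Cls (fun x => F (x - y)).
Hypothesis Cls_char : forall I, is_basis I -> Cls (lattice_char I).

Lemma Cls_sum (S : Type) (l : seq S) (P : pred S) (F : S -> W -> A) :
  (forall i, P i -> Cls (F i)) -> Cls (fun x => \sum_(i <- l | P i) F i x).
Proof.
move=> HF; elim: l => [|i l IH].
  by under eq_fun do rewrite big_nil.
under eq_fun do rewrite big_cons; case Pi : (P i) => //.
by apply: ClsD => //; apply: HF.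
Qed.

Lemma shift_comb_class q F : (forall p, p \in q -> L p.2) -> Cls F ->
  Cls (shift_comb q F).
Proof.
move=> qL cF; have -> : shift_comb q F =
    fun x => \sum_(p <- q | p \in q) p.1 * F (x - p.2).
  by apply/funext => x; exact: big_seq.
by apply: Cls_sum => p /qL Lp; apply: ClsZ; apply: Cls_shift.
Qed.

Lemma chamber_rec_class m J : Cls (chamber_rec m J).
Proof.
elim: m J => [|m IH] J /=; case lJ : (live J) => //=;
  case JB : (J \in BB) => //; try exact/ClsZ/Cls_char/BB_basis.
have [I [_ bI IJ]] := live_proper lJ (negbT JB).
apply: ClsZ; apply: Cls_sum => k _; apply: shift_comb_class => //.
exact: (ops_L bI IJ).
Qed.

End ChamberFormula.

(** Ring, character and class stay abstract here; they become power series, a deformed exponential,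
    and functions whose coefficients are exponential polynomials on the lattice. *)
Theorem chamber_formula (R : archiRealFieldType) (W : vectType R)
    (A : comNzRingType) (T : finType) (b : T -> W) (h : {additive W -> R})
    (chi : (T -> R) -> A) (BB : {set {set T}}) (L : W -> Prop)
    (rel : {set T} -> T -> int) (e : A) (e' : {set T} -> A)
    (Cls : (W -> A) -> Prop) :
  (forall k, 1 <= h (b k)) ->
  (forall x, exists t : T -> R, x = \sum_k t k *: b k) ->
  (forall s t, chi (fun k => s k + t k) = chi s * chi t) ->
  chi (fun=> 0) = 1 ->
  (forall I, I \in BB -> is_basis b I) ->
  L 0 -> (forall x k, L x -> L (x + b k)) -> (forall x k, L x -> L (x - b k)) ->
  (forall I J : {set T}, is_basis b I -> I \proper J -> forall k, k \notin J -> rel J k = 0) ->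
  (forall I J : {set T}, is_basis b I -> I \proper J -> \sum_k b k *~ rel J k = 0) ->
  (forall I J : {set T}, is_basis b I -> I \proper J ->
     e = e' J * (1 - chi (fun k => (rel J k)%:~R))) ->
  (forall z, e * z = 0 -> z = 0) ->
  Cls (fun=> 0) ->
  (forall F G, Cls F -> Cls G -> Cls (fun x => F x + G x)) ->
  (forall a F, Cls F -> Cls (fun x => a * F x)) ->
  (forall s F, L s -> Cls F -> Cls (fun x => F (x - s))) ->
  (forall I, is_basis b I -> Cls (lattice_char b chi I)) ->
  exists2 P, Cls P & forall x t, in_chamber b BB x -> (forall k, 0 <= t k <= 1) ->
    e ^+ #|T| * psum b h chi finset.setT (x - \sum_k t k *: b k) = P (x - \sum_k t k *: b k).
Proof.
move=> hb b_span chiD chi0 BBb L0 LD LB rs r0 ef er C0 CD CZ Cs Cc.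
have [ops opsH] := relation_operators chiD chi0 L0 LD LB rs r0.
have oL (I J : {set T}) bI IJ := (opsH I J bI IJ).1.
have oE (I J : {set T}) bI IJ := (opsH I J bI IJ).2.
exists (chamber_fun b chi BB e e' ops finset.setT).
  apply: (chamber_rec_class BBb e e' oL C0 CD CZ Cs Cc).
move=> x t cx t01; rewrite -cardsT; apply/eqP; rewrite -subr_eq0; apply/eqP.
apply: (defect0 hb b_span chiD chi0 BBb ef er oE cx).
by split=> // k; rewrite inE.
Qed.

Definition fps (K : Type) := nat -> K.

(** * Formal power series *)

Section PowerSeries.
Variable K : comNzRingType.

HB.instance Definition _ := GRing.Zmodule.copy (fps K) (nat -> K).
Implicit Types f g : fps K.

Definition truncation n f : {poly K} := \poly_(i < n) f i.

Definition fps_mul f g : fps K := fun n => \sum_(i < n.+1) f i * g (n - i)%N.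
Definition fps_one : fps K := fun n => (n == 0%N)%:R.

Lemma coef_truncation n f i : (i < n)%N -> (truncation n f)`_i = f i.
Proof. by move=> lt_in; rewrite coef_poly lt_in. Qed.

(** Each coefficient of a product depends on finitely many others, so the ring laws are inherited
    from polynomials. *)
Lemma fps_mul_truncation n m f g : (n < m)%N ->
  fps_mul f g n = (truncation m f * truncation m g)`_n.
Proof.
move=> nm; rewrite coefM; apply: eq_bigr => i _.
rewrite !coef_truncation //; first exact: leq_ltn_trans (leq_subr _ _) nm.
by apply: leq_ltn_trans nm; rewrite -ltnS.
Qed.

Lemma fps_addE f g n : (f + g) n = f n + g n. Proof. by []. Qed.

Lemma fps_mulC : commutative fps_mul.
Proof.
move=> f g; apply/funext => n.
by rewrite !(fps_mul_truncation _ _ (ltnSn n)) mulrC.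
Qed.

Lemma coefM_eq (p q p' q' : {poly K}) n : (forall i, (i <= n)%N -> p`_i = p'`_i) ->
  (forall i, (i <= n)%N -> q`_i = q'`_i) -> (p * q)`_n = (p' * q')`_n.
Proof.
move=> pE qE; rewrite !coefM; apply: eq_bigr => i _.
by rewrite pE ?qE ?leq_subr // -ltnS.
Qed.

Lemma fps_mulA : associative fps_mul.
Proof.
move=> f g k; apply/funext => n; rewrite !(fps_mul_truncation _ _ (ltnSn n)).
rewrite (coefM_eq (p' := truncation n.+1 f)
  (q' := truncation n.+1 g * truncation n.+1 k)) //; last first.
  by move=> i i_n; rewrite coef_truncation // (fps_mul_truncation (m := n.+1)).
rewrite mulrA; apply: coefM_eq => // i i_n.
by rewrite coef_truncation // (fps_mul_truncation (m := n.+1)).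
Qed.

Lemma fps_mul1 : left_id fps_one fps_mul.
Proof.
move=> f; apply/funext => n; rewrite /fps_mul big_ord_recl subn0 mul1r.
by rewrite big1 ?addr0 // => i _; rewrite mul0r.
Qed.

Lemma fps_mulDl : left_distributive fps_mul +%R.
Proof.
move=> f g k; apply/funext => n; rewrite fps_addE /fps_mul -big_split /=.
by apply: eq_bigr => i _; rewrite fps_addE mulrDl.
Qed.

Lemma fps_one_neq0 : fps_one != 0.
Proof. by apply/eqP => /(congr1 (@^~ 0%N)) /eqP; rewrite /= oner_eq0. Qed.

HB.instance Definition _ := GRing.Zmodule_isComNzRing.Build (fps K)
  fps_mulA fps_mulC fps_mul1 fps_mulDl fps_one_neq0.

Lemma fps_mulE f g n : (f * g) n = \sum_(i < n.+1) f i * g (n - i)%N.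
Proof. by []. Qed.

Lemma fps_sumE (S : Type) (l : seq S) (P : pred S) (F : S -> fps K) n :
  (\sum_(i <- l | P i) F i) n = \sum_(i <- l | P i) F i n.
Proof. by apply: (big_morph (fun f : fps K => f n)). Qed.

Lemma fps_coef0X f m : (f ^+ m) 0%N = f 0%N ^+ m.
Proof.
elim: m => // m IH; by rewrite !exprS fps_mulE big_ord1 IH.
Qed.
End PowerSeries.

(** * Orders and leading coefficients of power series *)

Section Domain.
Variable K : idomainType.
Implicit Types f g : fps K.

Lemma fps_order f : f != 0 ->
  exists2 m, f m != 0 & forall i, (i < m)%N -> f i = 0.
Proof.
move=> f0; have exm : exists m, f m != 0.
  apply: contrapT => H; case/eqP: f0; apply/funext => m; apply/eqP.
  by apply: contrapT => /negP fm; apply: H; exists m.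
exists (ex_minn exm); case: ex_minnP => // m fm minm i im; apply/eqP.
by apply: contraLR im => /minm; rewrite leqNgt.
Qed.

Lemma fps_mul_leading f g m : (forall i, (i < m)%N -> f i = 0) ->
  forall n, (forall i, (i < n)%N -> g i = 0) -> (f * g) (m + n)%N = f m * g n.
Proof.
move=> f0 n g0; rewrite fps_mulE.
have mn : (m < (m + n).+1)%N by rewrite ltnS leq_addr.
rewrite (bigD1 (Ordinal mn)) //= addKn big1 ?addr0 // => i im.
have [/f0 ->|mi|eim] := ltngtP i m; first by rewrite mul0r.
  by rewrite [g _]g0 ?mulr0 // ltn_subLR ?ltn_add2r // -ltnS.
by case/eqP: im; apply: val_inj.
Qed.

Lemma fps_mulf_neq0 f g : f != 0 -> g != 0 -> f * g != 0.
Proof.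
move=> /fps_order[m fm f0] /fps_order[n gn g0].
apply/eqP => /(congr1 (@^~ (m + n)%N)); rewrite (fps_mul_leading f0 g0).
by apply/eqP; rewrite mulf_neq0.
Qed.

Lemma fps_prod_neq0 (S : Type) (l : seq S) (P : pred S) (F : S -> fps K) :
  (forall i, P i -> F i != 0) -> \prod_(i <- l | P i) F i != 0.
Proof.
move=> F0; elim/big_ind: _ => //; first exact: oner_neq0.
by move=> f g; apply: fps_mulf_neq0.
Qed.

End Domain.

Local Open Scope complex_scope.

(** * Exponential polynomials *)

Section ComplexExponential.
Variable R : realType.
Implicit Types z : R[i].

Lemma cexpD z z' : cexp (z + z') = cexp z * cexp z'.
Proof.
case: z z' => [a b] [c d]; rewrite /cexp /= expRD cosD sinD.
apply/eqP; rewrite eq_complex /=; apply/andP; split; apply/eqP; ring.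
Qed.

Lemma cexp0 : cexp 0 = 1 :> R[i].
Proof. by rewrite /cexp /= expR0 cos0 sin0 mulr1 mulr0. Qed.

Lemma cexp_neq0 z : cexp z != 0.
Proof.
apply/eqP => z0; have := cexpD z (- z); rewrite subrr cexp0 z0 mul0r => /eqP.
by rewrite oner_eq0.
Qed.

Lemma cexpMn z n : cexp (z *+ n) = cexp z ^+ n.
Proof. by elim: n => [|n IH]; rewrite ?mulr0n ?cexp0 ?expr0 // mulrS cexpD IH exprS. Qed.

Lemma cexp_sum (T : Type) (s : seq T) (P : pred T) (F : T -> R[i]) :
  cexp (\sum_(i <- s | P i) F i) = \prod_(i <- s | P i) cexp (F i).
Proof. by apply: (big_morph (@cexp R) cexpD cexp0). Qed.

Definition tau : R[i] := 0 +i* (pi *+ 2).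

Lemma cexp_tau (c : R) :
  cexp (c%:C * tau) = cos (c * pi *+ 2) +i* sin (c * pi *+ 2).
Proof. by rewrite /cexp /= !mul0r !mulr0 subr0 addr0 expR0 !mul1r mulrnAr. Qed.

Lemma cexp_tau_int (z : int) : cexp (z%:~R%:C * tau) = 1.
Proof.
have nat1 (n : nat) : cexp (n%:R%:C * tau) = 1.
  rewrite -[tau]mul1r rmorph_nat mulr_natl cexpMn.
  have -> : 1 * tau = 1%:C * tau :> R[i] by [].
  by rewrite cexp_tau mul1r cos2pi sin2pi expr1n.
case: z => n; first exact: nat1.
rewrite NegzE mulrNz rmorphN mulNr; apply: (mulfI (cexp_neq0 (n.+1%:R%:C * tau))).
by rewrite -cexpD subrr cexp0 nat1 mulr1.
Qed.

(** Let [r] be the fractional part of [c]. If [r != 0] then [sin (r * pi) > 0], whereas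
    [cos (2 r pi) = 1] forces [|cos (r * pi)| = 1]. *)
Lemma cexp_tau_eq1 (c : R) : cexp (c%:C * tau) = 1 -> c \is a Num.int.
Proof.
move=> c1; pose r := c - (Num.floor c)%:~R.
have r1 : cexp (r%:C * tau) = 1.
  move: c1; rewrite -{1}(subrK (Num.floor c)%:~R c) -/r rmorphD mulrDl cexpD /=.
  by rewrite cexp_tau_int mulr1.
have /andP[r0 rlt1] : 0 <= r < 1.
  rewrite subr_ge0 floor_le /= ltrBlDl.
  by have /andP[_] := floor_itv c; rewrite intrD addrC.
have [rE|rn0] := eqVneq r 0.
  by rewrite intrEfloor eq_sym -subr_eq0 -/r rE.
have spos : 0 < sin (r * pi).
  have r_gt0 : 0 < r by rewrite lt_def rn0.
  by apply: sin_gt0_pi; rewrite (mulr_gt0 r_gt0 (pi_gt0 _)) gtr_pMl ?pi_gt0.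
move: r1; rewrite cexp_tau => -[]; rewrite cos_mulr2n => cs _.
have : `|cos (r * pi)| = 1.
  apply/eqP; rewrite -(@eqrXn2 _ 2) // real_normK ?num_real // expr1n.
  by apply/eqP; move: cs; rewrite -mulr_natr; lra.
by move=> /cos1sin0 s0; rewrite s0 ltxx in spos.
Qed.

(** A geometric sum. Averaging over [M] detects integrality among the [c] with denominator dividing
    [M]. *)
Lemma sum_roots_of_unity (c : R) (M : nat) : (0 < M)%N ->
  c * M%:R \is a Num.int ->
  \sum_(j < M) cexp ((c * j%:R)%:C * tau) = if c \is a Num.int then M%:R else 0.
Proof.
move=> M0 cM.
have E j : cexp ((c * j%:R)%:C * tau) = cexp (c%:C * tau) ^+ j.
  by rewrite -cexpMn rmorphM rmorph_nat mulrAC mulr_natr.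
under eq_bigr do rewrite E.
case: ifPn => cint.
  have /intrP[z ->] := cint; under eq_bigr do rewrite cexp_tau_int expr1n.
  by rewrite sumr_const card_ord.
have c1 : cexp (c%:C * tau) - 1 != 0.
  by rewrite subr_eq0; apply: contraNneq cint => /cexp_tau_eq1.
apply: (mulfI c1); rewrite mulr0 -subrX1 -E.
by have /intrP[z ->] := cM; rewrite cexp_tau_int subrr.
Qed.

(** The Taylor series at [t = 0] of [e^(z + a t)]. *)
Definition expseries (z : R[i]) (a : R) : fps R[i] :=
  fun n => cexp z * (a ^+ n / n`!%:R)%:C.

Lemma expseries0 : expseries 0 0 = 1.
Proof.
apply/funext => -[|n]; rewrite /expseries cexp0 mul1r.
  by rewrite expr0 fact0 divr1.
by rewrite exprS mul0r mul0r.
Qed.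

Lemma expseriesD z z' a a' :
  expseries (z + z') (a + a') = expseries z a * expseries z' a'.
Proof.
apply/funext => n; rewrite fps_mulE /expseries cexpD.
under eq_bigr do rewrite mulrACA -rmorphM.
rewrite -mulr_sumr -rmorph_sum; congr (_ * _%:C).
rewrite addrC exprDn mulr_suml; apply: eq_bigr => i _.
have fn0 m : (m`!)%:R != 0 :> R by rewrite pnatr_eq0 -lt0n fact_gt0.
have i_n : (i <= n)%N by rewrite -ltnS.
rewrite -mulr_natr -(bin_fact i_n) !natrM.
have b0 : ('C(n, i))%:R != 0 :> R by rewrite pnatr_eq0 -lt0n bin_gt0.
by field; rewrite !fn0 b0.
Qed.

(** The coefficient of [t] is [- e^z a]. *)
Lemma expseries_neq1 z a : a != 0 -> 1 - expseries z a != 0.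
Proof.
move=> a0; apply: contraNneq a0 => E.
have : (1 - expseries z a) 1%N = 0 by rewrite E.
rewrite -[(_ - _) 1%N]/(0 - cexp z * (a ^+ 1 / 1`!%:R)%:C) sub0r divr1 expr1.
move=> /eqP; rewrite oppr_eq0 mulf_eq0 (negbTE (cexp_neq0 _)) /=.
by move=> /eqP [->].
Qed.
End ComplexExponential.

(** * Sums of exponential polynomials, products with polynomials and exponentials *)

Section ExponentialPolynomials.
Variables (R : realType) (W : vectType R).
Implicit Types F : W -> R[i].

Lemma exp_polynomial0 : exp_polynomial (fun _ : W => 0 : R[i]).
Proof.
exists 0%N, (fun=> \0), (fun=> 0).
by move=> w; rewrite big_ord0.
Qed.

Lemma exp_polynomialD F G : exp_polynomial F -> exp_polynomial G ->
  exp_polynomial (fun w => F w + G w).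
Proof.
move=> [m [y [P FE]]] [m' [y' [P' GE]]].
exists (m + m')%N, (fun j => match fintype.split j with inl i => y i | inr i => y' i end).
exists (fun j => match fintype.split j with inl i => P i | inr i => P' i end) => w.
rewrite FE GE big_split_ord; congr (_ + _); apply: eq_bigr => i _.
  by rewrite -[lshift _ _]/(unsplit (inl i)) unsplitK.
by rewrite -[rshift _ _]/(unsplit (inr i)) unsplitK.
Qed.

Lemma poly_evalM (P Q : mpoly.mpoly (\dim {:W}) R[i]) w :
  poly_eval (P * Q) w = poly_eval P w * poly_eval Q w.
Proof. by rewrite /poly_eval rmorphM. Qed.

Lemma exp_polynomial_mul_poly (Q : mpoly.mpoly (\dim {:W}) R[i]) F :
  exp_polynomial F -> exp_polynomial (fun w => poly_eval Q w * F w).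
Proof.
move=> [m [y [P FE]]]; exists m, y, (fun j => Q * P j) => w.
rewrite FE mulr_sumr; apply: eq_bigr => j _; rewrite poly_evalM; ring.
Qed.

Lemma exp_polynomialZ (c : R[i]) F :
  exp_polynomial F -> exp_polynomial (fun w => c * F w).
Proof.
have -> : (fun w => c * F w) = fun w => poly_eval (mpolyC _ c) w * F w.
  by apply/funext => w; rewrite /poly_eval mevalC.
exact: exp_polynomial_mul_poly.
Qed.

Lemma exp_polynomial_mul_linear (l : W -> R) F : linear (l : W -> R^o) ->
  exp_polynomial F -> exp_polynomial (fun w => (l w)%:C * F w).
Proof.
move=> lin_l; pose l' : {linear W -> R^o} :=
  HB.pack (l : W -> R^o) (GRing.isLinear.Build _ _ _ _ _ lin_l).
(* The linear form [l] as a polynomial in the coordinates. *)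
pose Q : mpoly (\dim {:W}) R[i] :=
  \sum_(i < \dim {:W}) mpolyC _ (l (vbasis {:W})`_i)%:C * mpolyX _ (mnm1 i).
have -> : (fun w => (l w)%:C * F w) = fun w => poly_eval Q w * F w.
  apply/funext => w; congr (_ * _); rewrite {1}(coord_vbasis (memvf w)).
  rewrite -[l _]/(l' _) linear_sum rmorph_sum /poly_eval rmorph_sum.
  apply: eq_bigr => i _; rewrite linearZ /= rmorphM mevalM mevalC mevalXU mulrC.
  by rewrite mxE.
exact: exp_polynomial_mul_poly.
Qed.

Lemma exp_polynomial_mul_cexp (l : W -> R[i]) F : linear (l : W -> Rcomplex R) ->
  exp_polynomial F -> exp_polynomial (fun w => cexp (l w) * F w).
Proof.
move=> lin_l; pose l' : {linear W -> Rcomplex R} :=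
  HB.pack (l : W -> Rcomplex R) (GRing.isLinear.Build _ _ _ _ _ lin_l).
move=> [m [y [P FE]]]; exists m, (fun j => l' \+ y j), P => w.
rewrite FE mulr_sumr; apply: eq_bigr => j _ /=.
by rewrite cexpD mulrA.
Qed.

Lemma exp_polynomial1 : exp_polynomial (fun _ : W => 1 : R[i]).
Proof.
exists 1%N, (fun=> \0), (fun=> 1) => w.
by rewrite big_ord1 /= cexp0 mul1r /poly_eval rmorph1.
Qed.

End ExponentialPolynomials.

(** * Factors evaluated at a translated argument *)

Section Shifts.
Variables (R : realType) (W : vectType R).
Implicit Types F : W -> R[i].

Lemma RcomplexZ (a : R) (z : R[i]) :
  (a *: (z : Rcomplex R) : Rcomplex R) = a%:C * z.
Proof.
by case: z => u v; apply/eqP; rewrite eq_complex /= !mul0r subr0 addr0 !eqxx.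
Qed.

Lemma linear_mul_complex (c : W -> R) (z : R[i]) : linear (c : W -> R^o) ->
  linear (fun w => (c w)%:C * z : Rcomplex R).
Proof. by move=> lin_c a u v; rewrite lin_c RcomplexZ rmorphD rmorphM mulrDl mulrA. Qed.

Lemma linear_sum_mul_complex (T : Type) (l : seq T) (c : T -> W -> R) (z : T -> R[i]) :
  (forall k, linear (c k : W -> R^o)) ->
  linear (fun w => \sum_(k <- l) (c k w)%:C * z k : Rcomplex R).
Proof.
move=> lin_c a u v; rewrite RcomplexZ mulr_sumr -big_split /=.
by apply: eq_bigr => k _; rewrite (linear_mul_complex (z k) (lin_c k)) RcomplexZ.
Qed.

Lemma linear_sum_mul (T : Type) (l : seq T) (c : T -> W -> R) (z : T -> R) :
  (forall k, linear (c k : W -> R^o)) ->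
  linear (fun w => \sum_(k <- l) c k w * z k : R^o).
Proof.
move=> lin_c a u v; rewrite scaler_sumr -big_split /=.
by apply: eq_bigr => k _; rewrite lin_c mulrDl scalerAl.
Qed.

Lemma exp_polynomial_ext F G : F =1 G -> exp_polynomial F -> exp_polynomial G.
Proof. by move=> /funext ->. Qed.

Lemma exp_polynomial_sum (T : Type) (l : seq T) (P : pred T) (F : T -> W -> R[i]) :
  (forall i, P i -> exp_polynomial (F i)) ->
  exp_polynomial (fun w => \sum_(i <- l | P i) F i w).
Proof.
move=> HF; elim: l => [|i l IH].
  by apply: exp_polynomial_ext (exp_polynomial0 W) => w; rewrite big_nil.
have [Pi|nPi] := boolP (P i).
  apply: exp_polynomial_ext (exp_polynomialD (HF i Pi) IH) => w.
  by rewrite big_cons Pi.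
by apply: exp_polynomial_ext IH => w; rewrite big_cons (negbTE nPi).
Qed.

Lemma exp_polynomial_mul_cexp_shift (l : W -> R[i]) s F :
  linear (l : W -> Rcomplex R) -> exp_polynomial F ->
  exp_polynomial (fun w => cexp (l (w - s)) * F w).
Proof.
move=> lin_l /(exp_polynomial_mul_cexp lin_l) /(exp_polynomialZ (cexp (- l s))).
apply: exp_polynomial_ext => w; rewrite mulrA -cexpD; congr (cexp _ * _).
pose l' : {linear W -> Rcomplex R} :=
  HB.pack (l : W -> Rcomplex R) (GRing.isLinear.Build _ _ _ _ _ lin_l).
by rewrite -[RHS]/(l' (w - s)) linearB addrC.
Qed.

Lemma exp_polynomial_mul_linear_shift (l : W -> R) s n F :
  linear (l : W -> R^o) -> exp_polynomial F ->
  exp_polynomial (fun w => (l (w - s) ^+ n)%:C * F w).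
Proof.
move=> lin_l epF; elim: n => [|n IH].
  by apply: exp_polynomial_ext epF => w; rewrite expr0 mul1r.
have := exp_polynomialD (exp_polynomial_mul_linear lin_l IH)
  (exp_polynomialZ (- (l s)%:C) IH).
apply: exp_polynomial_ext => w; rewrite -mulrDl mulrA; congr (_ * _).
pose l' : {linear W -> R^o} :=
  HB.pack (l : W -> R^o) (GRing.isLinear.Build _ _ _ _ _ lin_l).
by rewrite -[l (w - s)]/(l' (w - s)) linearB exprS rmorphM rmorphB.
Qed.

(** Where the coordinates have denominator dividing [M], the product is the indicator of integral
    coordinates; written this way it is a combination of exponentials. *)
Lemma exp_polynomial_mul_roots (T : eqType) (c : T -> W -> R) (M : nat) (l : seq T) s F :
  (forall k, linear (c k : W -> R^o)) -> exp_polynomial F ->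
  exp_polynomial (fun w =>
    (\prod_(k <- l) (M%:R^-1 * \sum_(j < M) cexp ((c k (w - s) * j%:R)%:C * tau R))) * F w).
Proof.
move=> lin_c epF; elim: l => [|k l IH].
  by apply: exp_polynomial_ext epF => w; rewrite big_nil mul1r.
have := @exp_polynomial_sum _ (index_enum 'I_M) xpredT (fun j w =>
   M%:R^-1 * (cexp ((c k (w - s) * j%:R)%:C * tau R) *
   ((\prod_(k <- l) (M%:R^-1 * \sum_(j < M) cexp ((c k (w - s) * j%:R)%:C * tau R))) * F w))).
set G := fun w => _; move=> H; apply: (@exp_polynomial_ext G).
  by move=> w; rewrite big_cons /G -mulr_sumr -mulr_suml !mulrA.
apply: H => j _; apply: exp_polynomialZ.
apply: (@exp_polynomial_mul_cexp_shift (fun w => (c k w * j%:R)%:C * tau R)) => //.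
apply: (@linear_mul_complex (fun w => c k w * j%:R)) => a u v.
by rewrite (lin_c k) mulrDl scalerAl.
Qed.
End Shifts.

Lemma exists_non_root (R : numFieldType) (p : {poly R}) : p != 0 ->
  exists x : R, ~~ root p x.
Proof.
move=> p0; pose rs := [seq i%:R : R | i <- iota 0 (size p)].
have uniq_rs : uniq rs.
  by rewrite map_inj_uniq ?iota_uniq // => i j /eqP; rewrite eqr_nat => /eqP.
have [all_root|] := boolP (all (root p) rs).
  by have := max_poly_roots p0 all_root uniq_rs; rewrite size_map size_iota ltnn.
by case/allPn => x _ px; exists x.
Qed.

(** * Exponential weights by deformation to power series *)

Section ExponentialWeights.
Variables (R : realType) (W : vectType R) (n : nat) (b : 'I_n -> W).
Variables (h : {additive W -> R}) (L : W -> Prop).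
Hypothesis hb : forall k, 1 <= h (b k).
Hypothesis b_span : forall x, exists t : 'I_n -> R, x = \sum_k t k *: b k.
Hypothesis L0 : L 0.
Hypothesis LB : forall x y, L x -> L y -> L (x - y).
Hypothesis Lb : forall k, L (b k).
Hypothesis L_denominator : forall I, is_basis b I -> exists2 M : nat, (0 < M)%N &
  forall x k, L x -> co b I k x * M%:R \is a Num.int.
Implicit Types (I J : {set 'I_n}).

Let LN x : L x -> L (- x). Proof. by move=> Lx; rewrite -sub0r; apply: LB. Qed.
Let LD x y : L x -> L y -> L (x + y).
Proof. by move=> Lx Ly; rewrite -[y]opprK; apply: LB => //; apply: LN. Qed.

(** Take [k0] in [J] outside a basis [I]. The common denominator [M] makes [M b_k0] an integer
    combination of the basis, and the relation so obtained has coefficient [M] at [k0]. *)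
Lemma integer_relation J : exists r : 'I_n -> int, forall I, is_basis b I ->
  I \proper J -> [/\ forall k, k \notin J -> r k = 0,
    \sum_k b k *~ r k = 0 & exists k, r k != 0].
Proof.
have [[I [bI IJ]]|H] := pselect (exists I, is_basis b I /\ I \proper J); last first.
  by exists (fun=> 0) => I bI IJ; case: H; exists I.
have [M M0 LM] := L_denominator bI.
have /properP[/fintype.subsetP sIJ [k0 k0J k0I]] := IJ.
have /choice[z zE] : forall k, exists z : int, co b I k (b k0) * M%:R = z%:~R.
  by move=> k; apply/intrP/LM/Lb.
exists (fun k => M%:Z *+ (k == k0) - z k) => _ _ _; split.
- move=> k kJ; have kk0 : k != k0 by apply: contraNneq kJ => ->.
  rewrite (negbTE kk0) mulr0n sub0r; apply/eqP; rewrite oppr_eq0 -(intr_eq0 R) -zE.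
  by rewrite co_notin ?mul0r //; apply: contra kJ; apply: sIJ.
- under eq_bigr do rewrite mulrzBr; rewrite sumrB; apply/eqP; rewrite subr_eq0.
  rewrite (bigD1 k0) //= eqxx big1 ?addr0 => [|i /negbTE ->]; last first.
    by rewrite mulr0n mulr0z.
  rewrite mulr1n -[b k0 *~ _]/(b k0 *+ M) -scaler_nat {1}(co_expand (b k0) bI).
  rewrite scaler_sumr; apply/eqP; apply: eq_bigr => k _.
  by rewrite scalerA mulrC zE scaler_int.
- exists k0; rewrite eqxx; have -> : z k0 = 0.
    by apply/eqP; rewrite -(intr_eq0 R) -zE co_notin ?mul0r.
  by rewrite subr0 -lt0n in M0 *.
Qed.

(** Along [g k = x ^+ k] each nonzero relation becomes a nonzero polynomial in [x]; one [x] that is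
    no root of their product serves all [J]. *)
Lemma generic_direction (r : {set 'I_n} -> 'I_n -> int) :
  exists g : 'I_n -> R, forall J, (exists k, r J k != 0) ->
    \sum_k (r J k)%:~R * g k != 0.
Proof.
pose p J : {poly R} := \poly_(i < n) oapp (fun k => (r J k)%:~R) 0 (insub i).
have pE J x : (p J).[x] = \sum_k (r J k)%:~R * x ^+ k.
  by rewrite horner_poly; apply: eq_bigr => i _; rewrite valK.
pose q := \prod_(J | [exists k, r J k != 0]) p J.
have q0 : q != 0.
  apply/prodf_neq0 => J /existsP[k rk]; apply: contraNneq rk.
  move=> /(congr1 (fun f : {poly R} => f`_k)).
  by rewrite coef_poly ltn_ord valK coef0 /= => /eqP; rewrite intr_eq0.
have [x xq] := exists_non_root q0; exists (fun k => x ^+ k) => J /existsP rJ.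
rewrite -pE; apply: contraNneq xq => pJ.
by rewrite rootE horner_prod (bigD1 J) //= pJ mul0r.
Qed.

Variable y : 'I_n -> R[i].

(* The character k |-> e^(y_k) deformed to e^(y_k + g_k t). *)
Definition series_char (g : 'I_n -> R) (a : 'I_n -> R) : fps R[i] :=
  expseries (\sum_k (a k)%:C * y k) (\sum_k a k * g k).

Lemma series_charD g s t : series_char g (fun k => s k + t k) =
  series_char g s * series_char g t.
Proof.
rewrite /series_char -expseriesD; congr expseries; rewrite -big_split /=;
  apply: eq_bigr => k _; first by rewrite rmorphD mulrDl.
by rewrite mulrDl.
Qed.

Lemma series_char0 g : series_char g (fun=> 0) = 1.
Proof.
rewrite /series_char !big1 ?expseries0 // => k _; first by rewrite mul0r.
by rewrite -[0%:C]/(0 : R[i]) mul0r.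
Qed.

(* The quantification over [s] makes this class stable under translations. *)
Definition exp_poly_series (F : W -> fps R[i]) := forall s, L s -> forall m,
  exists2 Q, exp_polynomial Q & forall x, L x -> F (x - s) m = Q x.

(** On [L] coordinates have denominator dividing [M], so the integrality test is an average of
    exponentials. The remaining factor has [t^m]-coefficient [e^c1 c2^m / m!] with [c1] and [c2]
    linear. *)
Lemma lattice_char_exp_poly g I : is_basis b I ->
  exp_poly_series (lattice_char b (series_char g) I).
Proof.
move=> bI s Ls m; have [M M0 LM] := L_denominator bI.
have lin_co k : linear (co b I k : W -> R^o) by exact: co_is_linear.
pose c1 w := \sum_k (co b I k w)%:C * y k.
pose c2 w := \sum_k co b I k w * g k.
exists (fun w => (\prod_(k <- index_enum 'I_n)
    (M%:R^-1 * \sum_(j < M) cexp ((co b I k (w - s) * j%:R)%:C * tau R))) *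
  (cexp (c1 (w - s)) * ((c2 (w - s) ^+ m)%:C * ((m`!%:R)^-1)%:C))).
  apply: exp_polynomial_mul_roots => //.
  apply: exp_polynomial_mul_cexp_shift; first exact: linear_sum_mul_complex.
  apply: exp_polynomial_mul_linear_shift; first exact: linear_sum_mul.
  apply: exp_polynomial_ext (exp_polynomialZ _ (exp_polynomial1 W)) => w.
  by rewrite mulr1.
move=> x Lx; rewrite /lattice_char.
have Lxs := LB Lx Ls.
have factor k : M%:R^-1 * \sum_(j < M) cexp ((co b I k (x - s) * j%:R)%:C * tau R)
    = (co b I k (x - s) \is a Num.int)%:R.
  rewrite sum_roots_of_unity ?LM //; case: ifP; rewrite ?mulr0 // mulVf //.
  by rewrite pnatr_eq0 -lt0n.
under eq_bigr do rewrite factor.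
case: ifPn => [/forallP int|/forallPn[k nint]].
  rewrite big1 ?mul1r => [|k _]; last by rewrite int.
  by rewrite -rmorphM.
by rewrite (bigD1 k) //= (negbTE nint) !mul0r.
Qed.

(** Setting [t = 0] respects sums and products and undoes the deformation. *)
Lemma iter_conv_coef0 g (s : seq 'I_n) x :
  iter_conv h (fun k => GRing.exp (weight (series_char g) k)) b s x 0%N =
  iter_conv h (fun k => GRing.exp (cexp (y k))) b s x.
Proof.
elim: s x => [|k s IH] x /=; first by rewrite /delta0; case: eqP.
rewrite /conv fps_sumE; apply: eq_bigr => j _.
rewrite fps_mulE big_ord1 IH fps_coef0X; congr (_ ^+ _ * _).
rewrite /weight /series_char /expseries expr0 fact0 divr1 mulr1; congr cexp.
rewrite (bigD1 k) //= /unit_vec eqxx mul1r big1 ?addr0 // => i /negbTE ->.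
by rewrite mul0r.
Qed.

Theorem exponential_weight_formula (BB : {set {set 'I_n}}) :
  (forall I, I \in BB -> is_basis b I) ->
  exists2 P, exp_polynomial P & forall x t, in_chamber b BB x ->
    (forall k, 0 <= t k <= 1) -> L (x - \sum_k t k *: b k) ->
    iter_conv h (fun k => GRing.exp (cexp (y k))) b (enum 'I_n)
       (x - \sum_k t k *: b k) = P (x - \sum_k t k *: b k).
Proof.
move=> BBb; have /choice[r rP] := integer_relation.
have [g gP] := generic_direction r.
pose chi := series_char g.
pose above J := [exists I, is_basis b I && (I \proper J)].
pose fac J := 1 - chi (fun k => (r J k)%:~R).
(* A common multiple of all the factors [1 - u^r], each nonzero because [g] is generic. *)
pose e := \prod_(J | above J) fac J.
have e0 : e != 0.
  apply: fps_prod_neq0 => J /existsP[I /andP[bI IJ]].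
  by apply: expseries_neq1; apply: gP; case: (rP J I bI IJ).
have clsD F G : exp_poly_series F -> exp_poly_series G ->
    exp_poly_series (fun x => F x + G x).
  move=> cF cG s Ls m; have [Q epQ FQ] := cF s Ls m; have [Q' epQ' GQ] := cG s Ls m.
  exists (fun x => Q x + Q' x); first exact: exp_polynomialD.
  by move=> x Lx; rewrite fps_addE FQ ?GQ.
have clsZ (a : fps R[i]) F : exp_poly_series F -> exp_poly_series (fun x => a * F x).
  move=> cF s Ls m; have /choice[Q QP] : forall i, exists Q, exp_polynomial Q /\
      forall x, L x -> F (x - s) i = Q x.
    by move=> i; have [Q] := cF s Ls i; exists Q.
  exists (fun x => \sum_(i < m.+1) a i * Q (m - i)%N x).
    by apply: exp_polynomial_sum => i _; apply: exp_polynomialZ; case: (QP (m - i)%N).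
  move=> x Lx; rewrite fps_mulE; apply: eq_bigr => i _.
  by case: (QP (m - i)%N) => _ ->.
have clsS s F : L s -> exp_poly_series F -> exp_poly_series (fun x => F (x - s)).
  move=> Ls cF s' Ls' m; have [Q epQ FQ] := cF (s' + s) (LD Ls' Ls) m.
  by exists Q => // x Lx; rewrite -FQ // opprD addrA.
have cls0 : exp_poly_series (fun=> 0).
  by move=> s Ls m; exists (fun=> 0) => //; apply: exp_polynomial0.
have e_reg z : e * z = 0 -> z = 0.
  have [//|zn0] := eqVneq z 0.
  by move/eqP; rewrite (negbTE (fps_mulf_neq0 e0 zn0)).
have e_fac I J : is_basis b I -> I \proper J ->
    e = (\prod_(J' | above J' && (J' != J)) fac J') * fac J.
  by move=> bI IJ; rewrite /e (bigD1 J) 1?mulrC //=; apply/existsP; exists I; rewrite bI.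
have LDb x k : L x -> L (x + b k) by move=> Lx; apply: LD.
have LBb x k : L x -> L (x - b k) by move=> Lx; apply: LB.
have [P clsP PE] := chamber_formula hb b_span (series_charD g) (series_char0 g) BBb L0
  LDb LBb
  (fun I J bI IJ => let: And3 H _ _ := rP J I bI IJ in H)
  (fun I J bI IJ => let: And3 _ H _ := rP J I bI IJ in H)
  e_fac e_reg cls0 clsD clsZ clsS (lattice_char_exp_poly g).
(* At the order [m] of the power of [e], its product with the partition sum has as coefficient a
   nonzero number times the constant term of that sum, which is the undeformed sum. Dividing by this
   number replaces the division by [1 - u^r]. *)
have [m em em0] : exists2 m, (e ^+ #|'I_n|) m != 0 &
    forall i, (i < m)%N -> (e ^+ #|'I_n|) i = 0.
  by apply: fps_order; rewrite -prodr_const; apply: fps_prod_neq0.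
have [Q epQ PQ] := clsP 0 L0 m.
exists (fun x => ((e ^+ #|'I_n|) m)^-1 * Q x); first exact: exp_polynomialZ.
move=> x t cx t01 Lz; set z := x - _ in Lz *.
rewrite -(iter_conv_coef0 g); apply: (mulfI em).
rewrite mulVKf // -PQ // subr0 -PE // -[in RHS](addn0 m) (fps_mul_leading em0) //.
by rewrite /psum enum_setT -enumT.
Qed.
End ExponentialWeights.

(** * Arbitrary exponential-polynomial weights *)

Section PartitionSums.
Variables (R : realType) (W : vectType R) (N : nat) (Phi : N.-tuple W).
Variable (h : {additive W -> R}).
Hypothesis hPhi : forall k, 1 <= h (tnth Phi k).

(** Every vector has height at least 1, so the coordinates of an integer point are at most
    [h lambda]. *)
Lemma partition_sum_ffun (f : 'rV[R]_N -> R[i]) lambda B :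
  (Num.truncn (h lambda) <= B)%N ->
  partition_sum f Phi lambda =
  \sum_(xi : {ffun 'I_N -> 'I_B.+1} | \sum_k tnth Phi k *+ xi k == lambda)
     f (\row_k (xi k)%:R).
Proof.
move=> hB; pose rho (xi : {ffun 'I_N -> 'I_B.+1}) : 'rV[R]_N := \row_k (xi k)%:R.
rewrite /partition_sum (@reindex_fsbig _ _ _ _ _ rho
  [set` (fun xi : {ffun 'I_N -> 'I_B.+1} => \sum_k tnth Phi k *+ xi k == lambda)]).
  rewrite -(@bigfs _ _ _ _ (index_enum _)) ?index_enum_uniq // => xi _.
  by rewrite mem_index_enum.
split.
- move=> xi /= /eqP xiE; split; first split.
  + by move=> k; rewrite mxE.
  + by rewrite -xiE; apply: eq_bigr => k _; rewrite mxE scaler_nat.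
  + by move=> k; rewrite mxE rpred_nat.
- move=> xi xi' _ _ /rowP E; apply/ffunP => k; apply/val_inj/eqP.
  by have := E k; rewrite !mxE => /eqP; rewrite eqr_nat.
- move=> x [[x0 xE] xint].
  have /choice[m mE] : forall k, exists m : nat, x 0 k = m%:R.
    by move=> k; apply/natrP; rewrite natrEint xint x0.
  have hE : h lambda = \sum_k h (tnth Phi k) *+ m k.
    rewrite -xE raddf_sum; apply: eq_bigr => k _.
    by rewrite mE scaler_nat raddfMn.
  have mB k : (m k < B.+1)%N.
    rewrite ltnS; apply: leq_trans hB; rewrite truncn_ge_nat; last first.
      by rewrite hE sumr_ge0 // => i _; rewrite mulrn_wge0 // (le_trans _ (hPhi i)).
    rewrite hE (bigD1 k) //=; apply: (@le_trans _ _ (h (tnth Phi k) *+ m k)).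
      by rewrite lerMn2r hPhi orbT.
    rewrite lerDl sumr_ge0 // => i _.
    by rewrite mulrn_wge0 // (le_trans _ (hPhi i)).
  exists [ffun k => Ordinal (mB k)].
    rewrite /= -xE; apply/eqP/eq_bigr => k _.
    by rewrite ffunE /= mE scaler_nat.
  by apply/rowP => k; rewrite mxE ffunE mE.
Qed.

(** The linear span of the products of binomial weights, as functions on tuples of naturals; one
    term is added at a time, to allow inductions on combinations. *)
Inductive binomial_span : (('I_N -> nat) -> R[i]) -> Prop :=
| binomial_span0 : binomial_span (fun=> 0)
| binomial_spanD (c : R[i]) (y : 'I_N -> R[i]) (m : 'I_N -> nat) F : binomial_span F ->
    binomial_span (fun xi => c * \prod_k binomial_weight (cexp (y k)) (m k) (xi k) + F xi).

Lemma binomial_span_ext F G : F =1 G -> binomial_span F -> binomial_span G.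
Proof. by move=> /funext ->. Qed.

Lemma binomial_span_add F G : binomial_span F -> binomial_span G ->
  binomial_span (fun xi => F xi + G xi).
Proof.
move=> sF sG; elim: sF => [|c y m F' _ IH].
  by apply: binomial_span_ext sG => xi; rewrite add0r.
by apply: binomial_span_ext (binomial_spanD c y m IH) => xi; rewrite addrA.
Qed.

Lemma binomial_span_scale a F : binomial_span F -> binomial_span (fun xi => a * F xi).
Proof.
elim=> [|c y m F' _ IH].
  by apply: binomial_span_ext binomial_span0 => xi; rewrite mulr0.
by apply: binomial_span_ext (binomial_spanD (a * c) y m IH) => xi; rewrite mulrDr mulrA.
Qed.

Lemma binomial_span_sum (T : Type) (l : seq T) (P : pred T) (F : T -> ('I_N -> nat) -> R[i]) :
  (forall i, P i -> binomial_span (F i)) ->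
  binomial_span (fun xi => \sum_(i <- l | P i) F i xi).
Proof.
move=> HF; elim: l => [|i l IH].
  by apply: binomial_span_ext binomial_span0 => w; rewrite big_nil.
have [Pi|nPi] := boolP (P i).
  apply: binomial_span_ext (binomial_span_add (HF i Pi) IH) => w.
  by rewrite big_cons Pi.
by apply: binomial_span_ext IH => w; rewrite big_cons (negbTE nPi).
Qed.

(** From [(m+1) C(j+m+1, m+1) = (j+m+1) C(j+m, m)]. Multiplication by [j] thus stays within binomial
    weights. *)
Lemma binomial_weight_mul (u : R[i]) m j : j%:R * binomial_weight u m j =
  m.+1%:R * binomial_weight u m.+1 j - m.+1%:R * binomial_weight u m j.
Proof.
rewrite /binomial_weight; set uj := u ^+ j.
have -> : j%:R * (uj * 'C(j + m, m)%:R) = uj * (j * 'C(j + m, m))%:R.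
  by rewrite natrM; ring.
have E : (m.+1 * 'C(j + m.+1, m.+1) = j * 'C(j + m, m) + m.+1 * 'C(j + m, m))%N.
  by rewrite addnS -mul_bin_diag -mulnDl addnS.
by rewrite -[RHS](_ : uj * ((m.+1 * 'C(j + m.+1, m.+1))%:R - (m.+1 * 'C(j + m, m))%:R) = _);
  [rewrite E natrD addrK | rewrite !natrM; ring].
Qed.

Lemma binomial_span_mul_coord k F : binomial_span F ->
  binomial_span (fun xi => (xi k)%:R * F xi).
Proof.
elim=> [|c y m F' _ IH].
  by apply: binomial_span_ext binomial_span0 => xi; rewrite mulr0.
pose m1 i := (m i + (i == k))%N.
apply: binomial_span_ext (binomial_spanD (c * (m k).+1%:R) y m1
  (binomial_spanD (- (c * (m k).+1%:R)) y m IH)) => xi.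
rewrite mulrDr addrA; congr (_ + _).
rewrite (bigD1 k) //= [in X in _ + X](bigD1 k) //= [in RHS](bigD1 k) //=.
rewrite /m1 eqxx addn1.
have -> : \prod_(i < N | i != k) binomial_weight (cexp (y i)) (m i + (i == k))%N (xi i) =
    \prod_(i < N | i != k) binomial_weight (cexp (y i)) (m i) (xi i).
  by apply: eq_bigr => i /negbTE ->; rewrite addn0.
set p := \prod_(i < N | _) _.
have := binomial_weight_mul (cexp (y k)) (m k) (xi k).
set q := binomial_weight _ _ _; set q1 := binomial_weight _ _ _ => qE.
have -> : (xi k)%:R * (c * (q * p)) = c * p * ((xi k)%:R * q) by ring.
rewrite qE; ring.
Qed.

(** An exponential is a product of binomial weights with [m = 0]; the coordinates are combinations
    of the [xi k], and multiplication by [xi k] preserves the span. *)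
Lemma exp_polynomial_span (f : 'rV[R]_N -> R[i]) : exp_polynomial f ->
  binomial_span (fun xi => f (\row_k (xi k)%:R)).
Proof.
case=> r [y [P fE]].
have rowE (xi : 'I_N -> nat) : \row_k (xi k)%:R =
    \sum_k (xi k)%:R *: (delta_mx 0 k : 'rV[R]_N).
  by rewrite {1}(row_sum_delta (\row_k _)); apply: eq_bigr => k _; rewrite mxE.
have coordsE xi i : (coords (\row_k (xi k)%:R : 'rV[R]_N) 0 i)%:C =
    \sum_k (coord (vbasis {:'rV[R]_N}) i (delta_mx 0 k))%:C * (xi k)%:R.
  rewrite mxE rowE linear_sum rmorph_sum; apply: eq_bigr => k _.
  by rewrite linearZ /= rmorphM rmorph_nat mulrC.
have cexpE (l : {linear 'rV[R]_N -> Rcomplex R}) xi : cexp (l (\row_k (xi k)%:R)) =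
    \prod_k binomial_weight (cexp (l (delta_mx 0 k))) 0 (xi k).
  rewrite rowE linear_sum cexp_sum; apply: eq_bigr => k _.
  by rewrite scaler_nat raddfMn cexpMn /binomial_weight bin0 mulr1.
apply: (@binomial_span_ext (fun xi => \sum_(j < r) cexp (y j (\row_k (xi k)%:R)) *
   poly_eval (P j) (\row_k (xi k)%:R))) => [xi|]; first by rewrite fE.
apply: binomial_span_sum => j _.
pose E xi := cexp (y j (\row_k (xi k)%:R)).
have spanE : binomial_span E.
  apply: binomial_span_ext (binomial_spanD 1 (fun k => y j (delta_mx 0 k))
    (fun=> 0%N) binomial_span0) => xi.
  by rewrite mul1r addr0 -cexpE.
apply: (@binomial_span_ext (fun xi => \sum_(m <- msupp (P j)) mcoeff m (P j) *
  ((\prod_i (coords (\row_k (xi k)%:R : 'rV[R]_N) 0 i)%:C ^+ m i) * E xi))) => [xi|].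
  rewrite /poly_eval mevalE mulr_sumr; apply: eq_bigr => m _.
  by rewrite /E; ring.
apply: binomial_span_sum => m _; apply: binomial_span_scale.
(* The monomial is multiplied in variable by variable and, for each variable, power by power. *)
elim: (index_enum _) => [|i s IH].
  by apply: binomial_span_ext spanE => xi; rewrite big_nil mul1r.
set G := fun xi => _ in IH.
apply: (@binomial_span_ext (fun xi =>
  (coords (\row_k (xi k)%:R : 'rV[R]_N) 0 i)%:C ^+ m i * G xi)).
  by move=> xi; rewrite big_cons /G mulrA.
elim: (m i) => [|e IHe]; first by apply: binomial_span_ext IH => xi; rewrite mul1r.
set H := fun xi => _ in IHe.
apply: (@binomial_span_ext (fun xi =>
  \sum_k (coord (vbasis {:'rV[R]_N}) i (delta_mx 0 k))%:C *
   ((xi k)%:R * H xi))).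
  move=> xi; rewrite exprS -mulrA {1}coordsE mulr_suml.
  by apply: eq_bigr => k _; rewrite mulrA.
apply: binomial_span_sum => k _; apply: binomial_span_scale.
exact: binomial_span_mul_coord.
Qed.

End PartitionSums.

(** * The dual lattice and the chamber *)

Section DualLattice.
Variables (R : realType) (V : vectType R) (n : nat) (Gamma : set V).
Hypotheses (dimV : \dim {:V} = n) (latticeG : lattice n Gamma).
Local Notation W := 'Hom(V, R^o).

Lemma dual_lattice0 : dual_lattice Gamma 0.
Proof. by move=> g _; rewrite zero_lfunE rpred0. Qed.

Lemma dual_latticeB x y : dual_lattice Gamma x -> dual_lattice Gamma y ->
  dual_lattice Gamma (x - y).
Proof. by move=> dx dy g Gg; rewrite add_lfunE opp_lfunE rpredB ?dx ?dy. Qed.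

Lemma dim_dual : \dim {:W} = n.
Proof. by rewrite dimvf /dim /= -dimV dimvf /dim /= muln1. Qed.

(** Cramer's rule for the integer matrix of values of the basis [I] on a basis of [Gamma]; its
    determinant is a common denominator. *)
Lemma dual_lattice_denominator (T : finType) (b : T -> W) (I : {set T}) :
  (forall k, dual_lattice Gamma (b k)) -> is_basis b I ->
  exists2 M : nat, (0 < M)%N &
    forall x k, dual_lattice Gamma x -> co b I k x * M%:R \is a Num.int.
Proof.
move=> bL bI; have In : #|I| = n by rewrite -dim_dual (vector.size_basis bI).
(* Evaluation at a basis of [Gamma] is integral on the dual lattice and determines a linear form. *)
have [e [e_int e_inj]] : exists e : 'I_#|I| -> V,
    (forall x, dual_lattice Gamma x -> forall j, (x (e j) : R) \is a Num.int) /\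
    (forall x : W, (forall j, x (e j) = 0) -> x = 0).
  have [v fv GE] := latticeG.
  exists (fun j => tnth v (cast_ord In j)); split=> [x dx j|x x0].
    apply: dx; rewrite GE; exists (fun i => (i == cast_ord In j)%:Z).
    rewrite (bigD1 (cast_ord In j)) //= eqxx big1 ?addr0 // => i /negbTE -> //.
  have bv : basis_of {:V} v.
    by rewrite basisEfree fv subvf size_tuple dimV leqnn.
  apply/lfunP => w; rewrite zero_lfunE (coord_basis bv (memvf w)) linear_sum big1 // => i _.
  rewrite linearZ /= -(cast_ordKV In i) -tnth_nth x0 scaler0 //.
pose r (x : W) : 'rV[R]_#|I| := \row_l (x (e l) : R).
have /choice[r' r'E] : forall x, exists r' : 'rV[int]_#|I|,
    dual_lattice Gamma x -> r x = map_mx intr r'.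
  move=> x; have [dx|ndx] := pselect (dual_lattice Gamma x); last by exists 0.
  have /choice[z zE] : forall l, exists z : int, (x (e l) : R) = z%:~R.
    by move=> l; apply/intrP/e_int.
  by exists (\row_l z l) => _; apply/rowP => l; rewrite !mxE.
pose B' : 'M[int]_#|I| := \matrix_j r' (b (enum_val j)).
pose B : 'M[R]_#|I| := \matrix_j r (b (enum_val j)).
have BE : B = map_mx intr B'.
  by apply/row_matrixP => j; rewrite -map_row !rowK r'E.
have rE x : r x = (\row_j co b I (enum_val j) x) *m B.
  apply/rowP => l; rewrite !mxE {1}(co_expand x bI) sum_lfunE.
  rewrite (bigID (mem I)) /= [X in _ + X]big1 ?addr0 => [|k kI]; last first.
    by rewrite co_notin // scale0r zero_lfunE.
  by rewrite big_enum_val; apply: eq_bigr => j _; rewrite !mxE scale_lfunE.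
have Bfree : row_free B.
  apply: inj_row_free => v vB; apply/rowP => j; rewrite mxE.
  pose x : W := \sum_(i < #|I|) v 0 i *: b (enum_val i).
  have x0 : x = 0.
    apply: e_inj => l; have := congr1 (fun u : 'rV[R]_#|I| => u 0 l) vB.
    rewrite !mxE => <-; rewrite sum_lfunE; apply: eq_bigr => i _.
    by rewrite !mxE scale_lfunE.
  have /freeP fI := basis_free bI; apply: (fI (fun i => v 0 i)).
  by rewrite -[RHS]x0; apply: eq_bigr => i _; rewrite vecs_nth.
have detB : \det B != 0 by rewrite -unitfE -unitmxE -row_free_unit.
exists `|\det B'|%N.
  by rewrite absz_gt0 -(intr_eq0 R) -det_map_mx -BE.
move=> x k dx; have [kI|kI] := boolP (k \in I); last first.
  by rewrite co_notin // mul0r rpred0.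
(* Multiplying by the adjugate isolates the coordinate times the determinant. *)
have := congr1 (fun u => (u *m \adj B) 0 (enum_rank_in kI k)) (rE x).
rewrite /= -mulmxA mul_mx_adj mul_mx_scalar !mxE enum_rankK_in // => cE.
have : co b I k x * \det B \is a Num.int.
  rewrite mulrC -cE; apply: rpred_sum => j _.
  by rewrite (r'E _ dx) BE -map_mx_adj !mxE rpredM // rpred_int.
rewrite BE det_map_mx; case: (\det B') => m //.
by rewrite NegzE /= mulrNz mulrN rpredN.
Qed.
End DualLattice.

Local Open Scope classical_set_scope.

(** * Signs of basis coordinates on a conic chamber *)

Section ChamberSigns.
Variables (R : realType) (W : vectType R).

Lemma linear_vtopology_continuous (l : W -> R) : linear (l : W -> R^o) ->
  continuous (l : vtopology W -> R).
Proof.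
move=> lin_l; pose l' : {linear W -> R^o} :=
  HB.pack (l : W -> R^o) (GRing.isLinear.Build _ _ _ _ _ lin_l).
pose phi (r : 'rV[R]_(\dim {:W})) : R :=
  \sum_(i < \dim {:W}) r 0 i * l ((vbasis {:W})`_i).
have -> : (l : vtopology W -> R) = phi \o (@coords R W : vtopology W -> _).
  apply/funext => w /=; rewrite {1}(coord_vbasis (memvf w)).
  rewrite -[l _]/(l' _) linear_sum; apply: eq_bigr => i _.
  by rewrite linearZ /= mxE.
have cont_phi : continuous phi.
  rewrite /phi; elim: (index_enum _) => [|i s IH] r.
    have -> : (fun r : 'rV[R]_(\dim {:W}) =>
        \sum_(i <- [::]) r 0 i * l (vbasis {:W})`_i) = fun=> 0.
      by apply/funext => ?; rewrite big_nil.
    exact: cst_continuous.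
  have -> : (fun r : 'rV[R]_(\dim {:W}) =>
      \sum_(i <- i :: s) r 0 i * l (vbasis {:W})`_i) =
    fun r => r 0 i * l (vbasis {:W})`_i + \sum_(i <- s) r 0 i * l (vbasis {:W})`_i.
    by apply/funext => ?; rewrite big_cons.
  apply: cvgD; [exact: (@nbhs_filter _ r)| |exact: IH].
  apply: cvgM; [exact: (@nbhs_filter _ r)| |apply: cvg_cst; exact: (@nbhs_filter _ r)].
  exact: (@coord_continuous _ _ _ 0 i r).
move=> w; apply: continuous_comp; first exact: initial_continuous.
exact: cont_phi.
Qed.

(** Positivity of all coordinates is open and nonnegativity is closed. Off the walls they agree, so
    connectedness makes them hold on all of [c] or nowhere on it. *)
Lemma conic_chamber_signs (s : seq W) (c : set W) (T : finType) (b : T -> W)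
    (I : {set T}) : conic_chamber s c -> (forall k, b k \in s) -> is_basis b I ->
  (forall x, c x -> forall k, k \in I -> 0 < co b I k x) \/
  (forall x, c x -> exists2 k, k \in I & co b I k x < 0).
Proof.
move=> [x0 x0X cE] bs bI.
have conn_c : connected (c : set (vtopology W)) by rewrite cE; apply: component_connected.
have cX : c `<=` closed_cone s `\` walls s.
  by rewrite cE; apply: (@connected_component_sub (vtopology W)).
have cont k : continuous (co b I k : vtopology W -> R).
  by apply: linear_vtopology_continuous; apply: co_is_linear.
(* A coordinate vanishing at [k] would put [x] in the cone of the [b i] with [i] in [I :\ k], which
   is a wall. *)
have off_wall x : c x -> (forall k, k \in I -> 0 <= co b I k x) ->
    forall k, k \in I -> 0 < co b I k x.
  move=> cx pos k kI; rewrite lt_def pos // andbT; apply/eqP => ck0.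
  have [_] := cX _ cx; apply; exists [seq b i | i <- enum (I :\ k)]; split.
  - by move=> w /mapP[i _ ->].
  - by rewrite size_map -cardE (vector.size_basis bI) [in RHS](cardsD1 k I) kI.
  - have := basis_free bI; have perm : perm_eq (enum I) (k :: enum (I :\ k)).
      apply: uniq_perm; rewrite /= ?enum_uniq ?mem_enum ?in_setD1 ?eqxx //.
      move=> i; rewrite in_cons !mem_enum in_setD1.
      by case: eqVneq => [->|//]; rewrite kI.
    by rewrite (perm_free (perm_map b perm)) /= free_cons => /andP[].
  - set u := map _ _.
    exists (fun i => co b I (nth k (enum (I :\ k)) i) x).
      move=> i; apply: pos; have : (i < size (enum (I :\ k)))%N.
        by rewrite -(size_map b) ltn_ord.
      by move/(mem_nth k); rewrite mem_enum in_setD1 => /andP[].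
    rewrite {1}(co_expand x bI) (bigID (mem (I :\ k))) /=.
    rewrite [X in _ + X]big1 ?addr0 => [|i]; last first.
      rewrite in_setD1 negb_and negbK => /orP[/eqP ->|iI].
        by rewrite ck0 scale0r.
      by rewrite co_notin // scale0r.
    rewrite -big_enum (big_nth k) big_mkord /u size_map.
    by apply: eq_bigr => i _; rewrite (nth_map k).
pose P : set (vtopology W) := [set x | forall k, k \in I -> 0 < co b I k x].
pose Q : set (vtopology W) := [set x | forall k, k \in I -> 0 <= co b I k x].
have openP : open P.
  have -> : P = ~` \bigcup_(k in [set` I]) [set x | co b I k x <= 0].
    apply/seteqP; split=> x /=.
      by move=> Px [k kI] /=; rewrite leNgt (Px k kI).
    by move=> H k kI; rewrite ltNge; apply/negP => ?; apply: H; exists k.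
  apply: closed_openC; apply: closed_bigcup => // k _.
  by apply: (@preimage_closed _ _ (co b I k : vtopology W -> R) [set r | r <= 0]);
    [move=> ? _; apply: cont | apply: closed_le].
have closedQ : closed Q.
  have -> : Q = \bigcap_(k in [set` I]) [set x | 0 <= co b I k x].
    by apply/seteqP; split=> x /= H k; apply: H.
  apply: closed_bigI => k _.
  by apply: (@preimage_closed _ _ (co b I k : vtopology W -> R) [set r | 0 <= r]);
    [move=> ? _; apply: cont | apply: closed_ge].
have PQ : c `&` P = c `&` Q.
  apply/seteqP; split=> x [cx Hx]; split=> // k kI; first by apply: ltW; apply: Hx.
  exact: off_wall.
have [[x1 x1P]|noP] := pselect ((c `&` P) !=set0).
  left; have <- : c `&` P = c.
    by apply: conn_c; [exists x1|exists P|exists Q].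
  by move=> x [].
right=> x cx; apply: contrapT => H; apply: noP; exists x; split=> //.
apply: off_wall => // k kI; rewrite leNgt; apply/negP => ck.
by apply: H; exists k.
Qed.

End ChamberSigns.

(** * From exponential weights to all weights *)

Section PartitionSumFormula.
Variables (R : realType) (W : vectType R) (N : nat) (Phi : N.-tuple W).
Variables (h : {additive W -> R}) (L : W -> Prop) (c : set W).
Hypothesis hPhi : forall k, 1 <= h (tnth Phi k).
Hypothesis Phi_span : <<Phi>>%VS = fullv.
Hypothesis c_chamber : conic_chamber Phi c.
Hypothesis L0 : L 0.
Hypothesis LB : forall x y, L x -> L y -> L (x - y).
Hypothesis LPhi : forall k, L (tnth Phi k).
Hypothesis L_denominator : forall (T : finType) (b : T -> W) (I : {set T}),
  (forall k, L (b k)) -> is_basis b I ->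
  exists2 M : nat, (0 < M)%N &
    forall x k, L x -> co b I k x * M%:R \is a Num.int.

Lemma binomial_weight_formula (y : 'I_N -> R[i]) (m : 'I_N -> nat) :
  exists2 P, exp_polynomial P & forall lambda B,
    [set x - y | x in c & y in box Phi] lambda -> L lambda ->
    (Num.truncn (h lambda) <= B)%N ->
    \sum_(xi : {ffun 'I_N -> 'I_B.+1} | \sum_k tnth Phi k *+ xi k == lambda)
      \prod_k binomial_weight (cexp (y k)) (m k) (xi k) = P lambda.
Proof.
(* Each [k] occurs [m k + 1] times, as [iter_conv_multiplicity] requires. *)
pose ks := flatten [seq nseq (m k).+1 k | k <- enum 'I_N].
pose b i := tnth Phi (tnth (in_tuple ks) i).
have sum_ks (F : 'I_N -> W) :
    \sum_(i < size ks) F (tnth (in_tuple ks) i) = \sum_k F k *+ (m k).+1.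
  rewrite -(big_tnth _ _ ks xpredT F) /ks big_flatten big_map big_enum.
  apply: eq_bigr => k _; rewrite big_nseq.
  by elim: (m k).+1 => [//|j IH]; rewrite iterS IH mulrS.
(* Splitting each coefficient evenly among the copies carries spanning and box membership over to
   the repeated family. *)
have scatter (t : 'I_N -> R) : \sum_k t k *: tnth Phi k =
    \sum_(i < size ks) (t (tnth (in_tuple ks) i) /
      (m (tnth (in_tuple ks) i)).+1%:R) *: b i.
  rewrite (sum_ks (fun k => (t k / (m k).+1%:R) *: tnth Phi k)).
  by apply: eq_bigr => k _; rewrite -scaler_nat scalerA mulrC divfK // pnatr_eq0.
have hb i : 1 <= h (b i) by exact: hPhi.
have b_span x : exists t : 'I_(size ks) -> R, x = \sum_i t i *: b i.
  have xs : x \in <<Phi>>%VS by rewrite Phi_span memvf.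
  exists (fun i => coord Phi (tnth (in_tuple ks) i) x /
    (m (tnth (in_tuple ks) i)).+1%:R).
  rewrite -(scatter (fun k => coord Phi k x)) {1}(coord_span xs).
  by apply: eq_bigr => k _; rewrite -tnth_nth.
(* The bases whose open cone contains [c]; by the sign dichotomy any other basis has a negative
   coordinate at every point of [c]. *)
pose BB := [set I : {set 'I_(size ks)} | is_basis b I &
  `[< forall x, c x -> forall k, k \in I -> 0 < co b I k x >]]%SET.
have BBb I : I \in BB -> is_basis b I by rewrite inE => /andP[].
have Lb i : L (b i) by exact: LPhi.
have chamber x : c x -> in_chamber b BB x.
  move=> cx I bI; case: ifPn; first by rewrite inE => /andP[_ /asboolP]; apply.
  have [pos|neg] := conic_chamber_signs c_chamber (fun i => mem_tnth _ Phi) bI.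
    by rewrite inE bI /= => /asboolP.
  by move=> _; apply: neg.
have [P epP PE] := exponential_weight_formula hb b_span L0 LB Lb
  (fun I => L_denominator Lb (I := I)) (fun i => y (tnth (in_tuple ks) i)) BBb.
exists P => // lambda B [x cx [z [t t01 zE] lE]] Llambda hB.
pose s (i : 'I_(size ks)) := t (cast_ord (esym (size_tuple Phi)) (tnth (in_tuple ks) i)) /
  (m (tnth (in_tuple ks) i)).+1%:R.
have s01 i : 0 <= s i <= 1.
  have /andP[t0 t1] := t01 (cast_ord (esym (size_tuple Phi)) (tnth (in_tuple ks) i)).
  rewrite /s divr_ge0 //= ler_pdivrMr ?ltr0n // mul1r (le_trans t1) //.
  by rewrite ler1n.
have lambdaE : lambda = x - \sum_i s i *: b i.
  rewrite -lE zE -(scatter (fun k => t (cast_ord (esym (size_tuple Phi)) k))).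
  congr (_ - _).
  rewrite (reindex (cast_ord (esym (size_tuple Phi)))) /=; last first.
    by exists (cast_ord (size_tuple Phi)) => k _; rewrite ?cast_ordK ?cast_ordKV.
  by apply: eq_bigr => k _; rewrite [in RHS](tnth_nth 0).
have := PE x s (chamber x cx) s01; rewrite -lambdaE => <- //.
rewrite -[RHS]/(iter_conv h ((fun k => GRing.exp (cexp (y k))) \o tnth (in_tuple ks))
  (tnth Phi \o tnth (in_tuple ks)) _ _).
rewrite iter_conv_map map_tnth_enum /= iter_conv_multiplicity //.
rewrite (iter_conv_sum _ hPhi (enum_uniq _) hB).
apply: eq_bigr => xi _; apply: eq_bigr => k _; by rewrite mem_enum.
Qed.

(** Both sides are linear in the weight, so binomial weights suffice. *)
Lemma partition_sum_formula (f : 'rV[R]_N -> R[i]) : exp_polynomial f ->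
  exists2 P, exp_polynomial P & forall lambda,
    [set x - y | x in c & y in box Phi] lambda -> L lambda ->
    partition_sum f Phi lambda = P lambda.
Proof.
move=> /exp_polynomial_span; set F := fun xi => _ => sF.
suff [P epP PE] : exists2 P, exp_polynomial P & forall lambda B,
    [set x - y | x in c & y in box Phi] lambda -> L lambda ->
    (Num.truncn (h lambda) <= B)%N ->
    \sum_(xi : {ffun 'I_N -> 'I_B.+1} | \sum_k tnth Phi k *+ xi k == lambda)
      F (fun k => xi k) = P lambda.
  exists P => // lambda cl Ll.
  by rewrite (partition_sum_ffun hPhi f (leqnn _)) -(PE _ _ cl Ll (leqnn _)).
elim: sF => [|a y m G _ [P epP PE]].
  exists (fun=> 0); first exact: exp_polynomial0.
  by move=> *; rewrite big1.
have [Q epQ QE] := binomial_weight_formula y m.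
exists (fun w => a * Q w + P w).
  by apply: exp_polynomialD => //; apply: exp_polynomialZ.
move=> lambda B cl Ll hB; rewrite big_split /= -mulr_sumr.
by rewrite (QE lambda B) // (PE lambda B).
Qed.

End PartitionSumFormula.

Unset Implicit Arguments.

Theorem theorem0p2 (R : realType) (n N : nat) (V : vectType R)
    (dimV : \dim {:V} = n)
    (Gamma : set V) (latticeG : lattice n Gamma)
    (Phi : N.-tuple 'Hom(V, R^o))
    (Phi_dual : forall k, dual_lattice Gamma (tnth Phi k))
    (Phi_span : <<Phi>>%VS = fullv)
    (Phi_half : in_open_halfspace Phi)
    (f : 'rV[R]_N -> R[i]) (f_ep : exp_polynomial f)
    (c : set 'Hom(V, R^o)) (c_chamber : conic_chamber Phi c) :
  exists2 P : 'Hom(V, R^o) -> R[i], exp_polynomial P &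
    forall lambda : 'Hom(V, R^o),
      [set x - y | x in c & y in box Phi] lambda ->
      dual_lattice Gamma lambda ->
      partition_sum f Phi lambda = P lambda.
Proof.
have [v _ v_pos] := Phi_half.
(* The sum dominates each inverse value, so evaluation at [a *: v] is at least 1 on all of [Phi]. *)
pose a := \sum_k (tnth Phi k v : R)^-1.
pose ev (l : 'Hom(V, R^o)) : R := l (a *: v).
have ev_additive : {morph ev : x y / x - y}.
  by move=> x y; rewrite /ev add_lfunE opp_lfunE.
pose h : {additive 'Hom(V, R^o) -> R} :=
  HB.pack ev (GRing.isZmodMorphism.Build _ _ ev ev_additive).
have hPhi k : 1 <= h (tnth Phi k).
  have pos i : 0 < (tnth Phi i v : R) by apply: v_pos; apply: mem_tnth.
  rewrite -[h _]/(tnth Phi k (a *: v) : R) linearZ /=.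
  rewrite -[_ *: _]/(a * (tnth Phi k v : R)) -ler_pdivrMr // div1r.
  rewrite /a (bigD1 k) //= lerDl sumr_ge0 // => i _.
  by rewrite invr_ge0 ltW.
apply: (partition_sum_formula hPhi Phi_span c_chamber) => //.
- exact: dual_lattice0.
- exact: dual_latticeB.
- by move=> T b I bL bI; apply: (dual_lattice_denominator dimV latticeG bL bI).
Qed.
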